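(* There exists a one-parameter (resp. two-parameter) family of homogeneous HKT structures on $\mathbb R^{4l}$, $l\ge 3$ (resp. $\mathbb R^{4l}$, $l\ge 4$). Moreover, for rational parameters there exist infinitely many non-isometric HKT nilmanifolds.
   Context: A hyperhermitian manifold $(M,\{J_i\}_{i=1,2,3},g)$ is a smooth manifold with a hypercomplex structure $\{J_i\}_{i=1,2,3}$ and a Riemannian metric $g$ that is Hermitian with respect to every $J_i$. It is HKT (hyperkähler with torsion) if there is a connection $\nabla$ with $\nabla g=0$, $\nabla J_i=0$ ($i=1,2,3$) and with $c(X,Y,Z)=g(X,T(Y,Z))$ a three-form, where $T$ is the torsion of $\nabla$. An HKT structure is homogeneous if a Lie group preserving the structure acts transitively. A nilmanifold is a compact quotient of a nilpotent Lie group by a discrete subgroup; an HKT nilmanifold is one carrying an HKT structure. The parameters are those of the following construction. For $p\ge 2$ identify $\mathbb R^{4p}$ with $\mathbb H^p$ ($\mathbb H$ the quaternions), with its canonical inner product, and let $J_1,J_2,J_3$ be right multiplication by $(i,\dots,i)$, $(j,\dots,j)$, $(-k,\dots,-k)$ respectively. Let $\mathfrak{sp}(p)=\{T\in\mathfrak{so}(4p): TJ_i=J_iT,\ i=1,2,3\}$, and let $L_{(q_1,\dots,q_p)}$ denote componentwise left multiplication. For $t>0$ let $j^t:\mathbb R^2\to\mathfrak{sp}(p)$ be the linear map with $j^t_{e_1}=L_{(i,\dots,i,i)}$, $j^t_{e_2}=L_{(j,\dots,j,tj)}$, where $e_1,e_2$ is a basis of $\mathbb R^2$. For $p\ge 3$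 and $0<t<s<1$ let $j^{t,s}:\mathbb R^3\to\mathfrak{sp}(p)$ be the linear map with $j^{t,s}_{e_1}=L_{(i,\dots,i,i)}$, $j^{t,s}_{e_2}=L_{(j,\dots,tj,j)}$, $j^{t,s}_{e_3}=L_{(k,\dots,k,sk)}$, where $e_1,e_2,e_3$ is a basis of $\mathbb R^3$. Given such a map $j:\mathbb R^m\to\mathfrak{sp}(p)$ ($m=2$ or $3$), put $\mathfrak n=\mathbb R^{4p}\oplus\mathbb R^{4-m}\oplus\mathbb R^m$ with the canonical inner product $g$, and define the bracket so that $\mathbb R^{4-m}\oplus\mathbb R^m$ is central, $[\mathbb R^{4p},\mathbb R^{4p}]\subset\mathbb R^m$, and $g([X,Y],z)=g(j_zX,Y)$ for $X,Y\in\mathbb R^{4p}$, $z\in\mathbb R^m$. Extend the $J_i$ to $\mathfrak n$ by endomorphisms of $\mathbb R^{4-m}\oplus\mathbb R^m$ satisfying the quaternion relations and compatible with the metric. This makes $\mathfrak n$ a 2-step nilpotent Lie algebra with an HKT structure, and left translation gives an invariant HKT structure on the simply connected Lie group with Lie algebra $\mathfrak n$, which is diffeomorphic to $\mathbb R^{4p+4}$ via the exponential map. The groups so obtained from $j^t$ and $j^{t,s}$ are denoted $N_t$ and $N_{t,s}$; the one-parameter family has parameter $t$ and the two-parameter family has parameters $(t,s)$, with $l=p+1$ in the claim. *)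

(* Defs.v *)
From HB Require Import structures.
From mathcomp Require Import all_boot all_order all_algebra.
From mathcomp Require Import all_classical all_reals all_analysis.

Set Implicit Arguments.
Unset Strict Implicit.
Unset Printing Implicit Defensive.

Import Order.TTheory GRing.Theory Num.Theory.
Import numFieldNormedType.Exports.

Local Open Scope classical_set_scope.
Local Open Scope ring_scope.

(* Vectors of R^n are columns and endomorphisms act by A *m v, so that the    *)
(* matrix product is the composition.                                         *)

Section SmoothMaps.
Variable R : realType.

Definition basis_vec n (i : 'I_n) : 'cV[R]_n := delta_mx i 0.

Definition jac m n (f : 'cV[R]_m -> 'cV[R]_n) (u : 'cV[R]_m) : 'M[R]_(n, m) :=
  \matrix_(k, i) ('D_(basis_vec i) f u) k 0.

(* f is C^k on U; only meaningful for open U *)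
Fixpoint Ck n (W : normedModType R) (k : nat) (U : set 'cV[R]_n)
    (f : 'cV[R]_n -> W) : Prop :=
  (forall u, U u -> {for u, continuous f}) /\
  (if k is k'.+1 then forall i : 'I_n,
     (forall u, U u -> derivable f u (basis_vec i)) /\
     Ck k' U (fun u => 'D_(basis_vec i) f u)
   else True).

Definition smooth n (W : normedModType R) (U : set 'cV[R]_n)
    (f : 'cV[R]_n -> W) : Prop :=
  forall k, Ck k U f.

End SmoothMaps.

(* Manifolds are presented by local parametrizations par a : dom a -> M with  *)
(* dom a open in R^n; the charts are their inverses.                          *)
Record chartedSpace (R : realType) (n : nat) := ChartedSpace {
  carrier :> Type;
  chart : Type;
  dom : chart -> set 'cV[R]_n;
  par : chart -> 'cV[R]_n -> carrier;
  dom_open : forall a, open (dom a) }.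

Section Topology.
Variables (R : realType) (n : nat) (M : chartedSpace R n).

Definition chart_open (A : set M) : Prop :=
  forall a : chart M, open (dom a `&` par a @^-1` A).

Lemma chart_openT : chart_open setT.
Proof. by move=> a; rewrite preimage_setT setIT; exact: dom_open. Qed.

Lemma chart_openI : setI_closed chart_open.
Proof.
move=> A B oA oB a; rewrite preimage_setI -[dom a]setIid setIACA.
by apply: openI; [exact: oA | exact: oB].
Qed.

Lemma chart_open_bigU (I : Type) (f : I -> set M) :
  (forall i, chart_open (f i)) -> chart_open (\bigcup_i f i).
Proof.
move=> fo a; rewrite preimage_bigcup setI_bigcupr.
by apply: bigcup_open => i _; exact: fo.
Qed.

End Topology.

HB.instance Definition _ (R : realType) (n : nat) (M : chartedSpace R n) :=
  gen_eqMixin (carrier M).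
HB.instance Definition _ (R : realType) (n : nat) (M : chartedSpace R n) :=
  gen_choiceMixin (carrier M).
HB.instance Definition _ (R : realType) (n : nat) (M : chartedSpace R n) :=
  isOpenTopological.Build (carrier M)
    (@chart_openT R n M) (@chart_openI R n M) (@chart_open_bigU R n M).

Section Manifolds.
Variable R : realType.
Implicit Types m n : nat.

Definition pimage n (M : chartedSpace R n) (a : chart M) : set M :=
  par a @` dom a.

(* the inverse of par a, arbitrary outside pimage a *)
Definition chart_coord n (M : chartedSpace R n) (a : chart M) (y : M) : 'cV[R]_n :=
  xget 0 [set v | dom a v /\ par a v = y].

Definition ldom m n (M : chartedSpace R m) (N : chartedSpace R n) (f : M -> N)
    (a : chart M) (b : chart N) : set 'cV[R]_m :=
  [set u | dom a u /\ pimage b (f (par a u))].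

Definition lmap m n (M : chartedSpace R m) (N : chartedSpace R n) (f : M -> N)
    (a : chart M) (b : chart N) : 'cV[R]_m -> 'cV[R]_n :=
  fun u => chart_coord b (f (par a u)).

(* For f = id, lmap is the transition map between two charts. *)
Definition is_manifold n (M : chartedSpace R n) : Prop :=
  [/\ forall a : chart M, {in dom a &, injective (par a)},
      forall y : M, exists a : chart M, pimage a y,
      forall a b : chart M,
        open (ldom (@id M) a b) /\ smooth (ldom (@id M) a b) (lmap (@id M) a b),
      hausdorff_space (carrier M) &
      @second_countable (carrier M)].

Definition smooth_map m n (M : chartedSpace R m) (N : chartedSpace R n)
    (f : M -> N) : Prop :=
  continuous f /\ forall a b, smooth (ldom f a b) (lmap f a b).

Definition smooth_map2 k m n (L : chartedSpace R k) (M : chartedSpace R m)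
    (N : chartedSpace R n) (f : L -> M -> N) : Prop :=
  continuous (fun xy : carrier L * carrier M => f xy.1 xy.2) /\
  forall (a : chart L) (b : chart M) (c : chart N),
    smooth
      [set w : 'cV[R]_(k + m) | [/\ dom a (usubmx w), dom b (dsubmx w) &
         pimage c (f (par a (usubmx w)) (par b (dsubmx w)))]]
      (fun w => chart_coord c (f (par a (usubmx w)) (par b (dsubmx w)))).

Definition euclidean n : chartedSpace R n :=
  @ChartedSpace R n 'cV[R]_n unit (fun=> setT) (fun _ => id) (fun=> openT).

(* Tensor fields are given by their components in each chart. *)
Definition tensor_field n (M : chartedSpace R n) (T : Type) :=
  chart M -> 'cV[R]_n -> T.

Definition smooth_tensor n (M : chartedSpace R n) (W : normedModType R)
    (h : tensor_field M W) : Prop :=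
  forall a : chart M, smooth (dom a) (h a).

(* f^* h' = h *)
Definition pulls_metric m n (M : chartedSpace R m) (N : chartedSpace R n)
    (f : M -> N) (h : tensor_field M 'M[R]_m) (h' : tensor_field N 'M[R]_n) :
    Prop :=
  forall a b u, ldom f a b u ->
    h a u = (jac (lmap f a b) u)^T *m h' b (lmap f a b u)
              *m jac (lmap f a b) u.

(* df o A = A' o df *)
Definition intertwines m n (M : chartedSpace R m) (N : chartedSpace R n)
    (f : M -> N) (A : tensor_field M 'M[R]_m) (A' : tensor_field N 'M[R]_n) :
    Prop :=
  forall a b u, ldom f a b u ->
    jac (lmap f a b) u *m A a u = A' b (lmap f a b u) *m jac (lmap f a b) u.

Definition riemannian_metric n (M : chartedSpace R n)
    (g : tensor_field M 'M[R]_n) : Prop :=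
  [/\ smooth_tensor g,
      pulls_metric (@id M) g g &
      forall a u, dom a u -> (g a u)^T = g a u /\
        forall v : 'cV[R]_n, v != 0 -> 0 < (v^T *m g a u *m v) 0 0].

Definition endo_field n (M : chartedSpace R n)
    (A : tensor_field M 'M[R]_n) : Prop :=
  smooth_tensor A /\ intertwines (@id M) A A.

Definition lie_bracket n (X Y : 'cV[R]_n -> 'cV[R]_n) : 'cV[R]_n -> 'cV[R]_n :=
  fun u => 'D_(X u) Y u - 'D_(Y u) X u.

(* The Nijenhuis tensor [AX,AY] - A[AX,Y] - A[X,AY] - [X,Y] vanishes; being   *)
(* tensorial, it is evaluated on coordinate fields, for which [X,Y] = 0.      *)
Definition integrable_cpx n (M : chartedSpace R n)
    (A : tensor_field M 'M[R]_n) : Prop :=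
  forall a u, dom a u -> forall i j : 'I_n,
    let X := fun=> basis_vec R i in
    let Y := fun=> basis_vec R j in
    let AX := fun v => A a v *m X v in
    let AY := fun v => A a v *m Y v in
    lie_bracket AX AY u - A a u *m lie_bracket AX Y u
      - A a u *m lie_bracket X AY u - lie_bracket X Y u = 0.

Definition quaternionic n (A : 'I_3 -> 'M[R]_n) : Prop :=
  [/\ forall i, A i *m A i = - 1%:M,
      A 0 *m A 1 = A 2%:R &
      A 1 *m A 0 = - A 2%:R].

Record hyperStructure n (M : chartedSpace R n) := HyperStructure {
  met : tensor_field M 'M[R]_n;
  cpx : 'I_3 -> tensor_field M 'M[R]_n }.

Definition hyperhermitian n (M : chartedSpace R n) (S : hyperStructure M) :
    Prop :=
  [/\ is_manifold M,
      riemannian_metric (met S),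
      forall i, endo_field (cpx S i) /\ integrable_cpx (cpx S i),
      forall a u, dom a u -> quaternionic (fun i => cpx S i a u) &
      forall i a u, dom a u ->
        (cpx S i a u)^T *m met S a u *m cpx S i a u = met S a u].

(* w a i u is the i-th connection matrix: nabla_(d_i) Y = d_i Y + w a i u *m Y,*)
(* i.e. (w a i u) k j is the Christoffel symbol Gamma^k_(ij). The equation is  *)
(* the change of charts rule.                                                  *)
Definition connection n (M : chartedSpace R n)
    (w : chart M -> 'I_n -> 'cV[R]_n -> 'M[R]_n) : Prop :=
  (forall a i, smooth (dom a) (w a i)) /\
  (forall a b u, ldom (@id M) a b u -> forall i : 'I_n,
     let phi := lmap (@id M) a b in
     'D_(basis_vec R i) (jac phi) u
       + (\sum_k jac phi u k i *: w b k (phi u)) *m jac phi u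
     = jac phi u *m w a i u).

(* T(d_i, d_j) *)
Definition torsion n (M : chartedSpace R n)
    (w : chart M -> 'I_n -> 'cV[R]_n -> 'M[R]_n) (a : chart M) (u : 'cV[R]_n)
    (i j : 'I_n) : 'cV[R]_n :=
  \col_l (w a i u l j - w a j u l i).

(* c(d_i, d_j, d_k) = g(d_i, T(d_j, d_k)) *)
Definition torsion3 n (M : chartedSpace R n) (g : tensor_field M 'M[R]_n)
    (w : chart M -> 'I_n -> 'cV[R]_n -> 'M[R]_n) (a : chart M) (u : 'cV[R]_n)
    (i j k : 'I_n) : R :=
  (g a u *m torsion w a u j k) i 0.

Definition HKT n (M : chartedSpace R n) (S : hyperStructure M) : Prop :=
  hyperhermitian S /\
  exists w : chart M -> 'I_n -> 'cV[R]_n -> 'M[R]_n,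
    connection w /\
    forall a u, dom a u ->
      [/\ forall i, 'D_(basis_vec R i) (met S a) u
            = (w a i u)^T *m met S a u + met S a u *m w a i u,
          forall r i, 'D_(basis_vec R i) (cpx S r a) u
            + w a i u *m cpx S r a u - cpx S r a u *m w a i u = 0 &
          forall i j k,
            torsion3 (met S) w a u i j k = - torsion3 (met S) w a u j i k /\
            torsion3 (met S) w a u i j k = - torsion3 (met S) w a u i k j].

Definition isometric m n (M : chartedSpace R m) (g : tensor_field M 'M[R]_m)
    (N : chartedSpace R n) (h : tensor_field N 'M[R]_n) : Prop :=
  exists (f : M -> N) (f' : N -> M),
    [/\ cancel f f', cancel f' f, smooth_map f, smooth_map f' &
        pulls_metric f g h].

End Manifolds.

Record groupSpace (R : realType) (n : nat) := GroupSpace {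
  gspace :> chartedSpace R n;
  gmul : gspace -> gspace -> gspace;
  gone : gspace;
  ginv : gspace -> gspace }.

Section LieGroups.
Variable R : realType.
Implicit Types m n : nat.

Definition lie_group n (G : groupSpace R n) : Prop :=
  is_manifold G /\
  [/\ associative (@gmul R n G),
      left_id (gone G) (@gmul R n G) &
      left_inverse (gone G) (@ginv R n G) (@gmul R n G)] /\
  smooth_map2 (@gmul R n G) /\ smooth_map (@ginv R n G).

Definition gcomm n (G : groupSpace R n) (x y : G) : G :=
  gmul (gmul (ginv x) (ginv y)) (gmul x y).

Fixpoint upper_central n (G : groupSpace R n) (c : nat) : set G :=
  if c is c'.+1 then [set x | forall y, upper_central c' (gcomm x y)]
  else [set gone G].

Definition nilpotent_group n (G : groupSpace R n) : Prop :=
  exists c, @upper_central n G c = setT.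

Definition homogeneous n (M : chartedSpace R n) (S : hyperStructure M) : Prop :=
  exists (k : nat) (G : groupSpace R k) (act : G -> M -> M),
    [/\ lie_group G,
        smooth_map2 act,
        (forall x, act (gone G) x = x) /\
          (forall a b x, act (gmul a b) x = act a (act b x)),
        forall x y : M, exists a, act a x = y &
        forall a, pulls_metric (act a) (met S) (met S) /\
          forall i, intertwines (act a) (cpx S i) (cpx S i)].

Definition discrete_subgroup n (G : groupSpace R n) (Gam : set G) : Prop :=
  [/\ Gam (gone G),
      forall x y, Gam x -> Gam y -> Gam (gmul x y),
      forall x, Gam x -> Gam (ginv x) &
      forall x, Gam x -> isolated Gam x].

Section Quotient.
Variables (n : nat) (G : groupSpace R n) (Gam : set G).

Definition gcoset (x : G) : set G := [set gmul c x | c in Gam].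

Definition qpoint : Type := {A : set G | exists x, A = gcoset x}.

Definition qproj (x : G) : qpoint :=
  exist (fun A => exists y, A = gcoset y) (gcoset x) (ex_intro _ x erefl).

(* The parametrizations of Gam\G are those of G followed by the projection,   *)
(* on the open sets where this is injective.                                  *)
Definition qchart : Type :=
  {aU : chart G * set 'cV[R]_n |
    [/\ open aU.2, aU.2 `<=` dom aU.1 &
        {in aU.2 &, injective (qproj \o par aU.1)}]}.

Definition qdom (c : qchart) : set 'cV[R]_n := (sval c).2.

Lemma qdom_open (c : qchart) : open (qdom c).
Proof. by case: c => aU []. Qed.

Definition quotient_space : chartedSpace R n :=
  @ChartedSpace R n qpoint qchart qdom
    (fun c => qproj \o par (sval c).1) qdom_open.

(* the same components in the charts of the quotient *)
Definition quotient_structure (S : hyperStructure G) :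
    hyperStructure quotient_space :=
  @HyperStructure R n quotient_space
    (fun c => met S (sval c).1) (fun i c => cpx S i (sval c).1).

End Quotient.

Definition HKT_nilmanifold n (G : groupSpace R n) (S : hyperStructure G)
    (Gam : set G) : Prop :=
  [/\ lie_group G,
      nilpotent_group G,
      discrete_subgroup Gam,
      compact [set: carrier (quotient_space Gam)] &
      HKT (quotient_structure Gam S)].

End LieGroups.

Section Quaternions.
Variable R : realType.

(* q in H has coordinates (qc q 0, ..., qc q 3) in the basis 1, i, j, k. *)
Definition qc (q : 'cV[R]_4) (r : nat) : R := q (inord r) 0.

Definition qmul (x y : 'cV[R]_4) : 'cV[R]_4 :=
  \col_(r < 4)
    [:: qc x 0 * qc y 0 - qc x 1 * qc y 1 - qc x 2 * qc y 2 - qc x 3 * qc y 3;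
        qc x 0 * qc y 1 + qc x 1 * qc y 0 + qc x 2 * qc y 3 - qc x 3 * qc y 2;
        qc x 0 * qc y 2 - qc x 1 * qc y 3 + qc x 2 * qc y 0 + qc x 3 * qc y 1;
        qc x 0 * qc y 3 + qc x 1 * qc y 2 - qc x 2 * qc y 1 + qc x 3 * qc y 0]`_r.

Definition qunit (k : nat) : 'cV[R]_4 := \col_(r < 4) (r == k :> nat)%:R.
Definition qi := qunit 1.
Definition qj := qunit 2.
Definition qk := qunit 3.

Definition lmulq (q : 'cV[R]_4) : 'M[R]_4 :=
  \matrix_(r, c) qmul q (basis_vec R c) r 0.
Definition rmulq (q : 'cV[R]_4) : 'M[R]_4 :=
  \matrix_(r, c) qmul (basis_vec R c) q r 0.

(* block diagonal matrix with diagonal blocks A 0, ..., A (p-1) *)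
Definition blocks p (A : nat -> 'M[R]_4) : 'M[R]_(4 * p) :=
  \matrix_(r, c) (if (r %/ 4 == c %/ 4)%N
                  then A (r %/ 4)%N (inord (r %% 4)) (inord (c %% 4)) else 0).

(* L_(q 0, ..., q (p-1)) on H^p *)
Definition leftL p (q : nat -> 'cV[R]_4) : 'M[R]_(4 * p) :=
  blocks p (fun b => lmulq (q b)).

Definition Hp_structure p (i : 'I_3) : 'M[R]_(4 * p) :=
  blocks p (fun=> rmulq [:: qi; qj; - qk]`_i).

End Quaternions.

Section NilGroups.
Variable R : realType.
(* j : R^m -> sp(p) is given by its values j r on the canonical basis. *)
Variables (p m : nat) (j : 'I_m -> 'M[R]_(4 * p)).

Let dimN := (4 * p + (4 - m + m))%N.

(* the component of [x, y] along e_r in R^m is g(j_(e_r) X, Y), with X, Y the *)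
(* components of x, y in R^(4p)                                               *)
Definition nil_bracket (x y : 'cV[R]_dimN) : 'cV[R]_dimN :=
  col_mx 0 (col_mx 0
    (\col_(r < m) ((j r *m usubmx x)^T *m usubmx y) 0 0)).

(* Exponential coordinates: the Baker-Campbell-Hausdorff product, which stops *)
(* at the first bracket since the Lie algebra is 2-step nilpotent.            *)
Definition nil_group : groupSpace R dimN :=
  @GroupSpace R dimN (euclidean R dimN)
    (fun x y : 'cV[R]_dimN => x + y + 2^-1 *: nil_bracket x y)
    0 (fun x : 'cV[R]_dimN => - x).

(* differential at the identity of the left translation by x *)
Definition dleft (x : 'cV[R]_dimN) : 'M[R]_dimN :=
  @jac R dimN dimN (@gmul R dimN nil_group x) 0.

(* K r is the extension of J_r to the center R^(4-m) + R^m *)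
Definition J_at_one (K : 'I_3 -> 'M[R]_(4 - m + m)) (i : 'I_3) : 'M[R]_dimN :=
  block_mx (Hp_structure R p i) 0 0 (K i).

(* left-invariant, equal to the canonical inner product and J_at_one at 0 *)
Definition nil_structure (K : 'I_3 -> 'M[R]_(4 - m + m)) :
    hyperStructure nil_group :=
  @HyperStructure R dimN nil_group
    (fun _ x => (invmx (dleft x))^T *m invmx (dleft x))
    (fun i _ x => dleft x *m J_at_one K i *m invmx (dleft x)).

End NilGroups.

Section Families.
Variable R : realType.

Definition center_extension n (K : 'I_3 -> 'M[R]_n) : Prop :=
  quaternionic K /\ forall i, (K i)^T *m K i = 1%:M.

Definition j1 (p : nat) (t : R) (r : 'I_2) : 'M[R]_(4 * p) :=
  [:: leftL p (fun=> qi R);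
      leftL p (fun b => if b == p.-1 then t *: qj R else qj R)]`_r.

Definition j2 (p : nat) (t s : R) (r : 'I_3) : 'M[R]_(4 * p) :=
  [:: leftL p (fun=> qi R);
      leftL p (fun b => if b == p.-2 then t *: qj R else qj R);
      leftL p (fun b => if b == p.-1 then s *: qk R else qk R)]`_r.

(* on R^(4 * p + 4) = R^(4 * l) for l = p.+1 *)
Definition N1 (p : nat) (t : R) := nil_group (j1 p t).
Definition N2 (p : nat) (t s : R) := nil_group (j2 p t s).

Definition HKT1 (p : nat) (K : 'I_3 -> 'M[R]_4) (t : R) :
  hyperStructure (N1 p t) := nil_structure (j1 p t) K.
Definition HKT2 (p : nat) (K : 'I_3 -> 'M[R]_4) (t s : R) :
  hyperStructure (N2 p t s) := nil_structure (j2 p t s) K.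

End Families.

(* Main.v *)
Require Import Defs.
From HB Require Import structures.
From mathcomp Require Import all_boot all_order all_algebra.
From mathcomp Require Import all_classical all_reals all_analysis.
From mathcomp Require Import ring lra zify.
Import Order.TTheory GRing.Theory Num.Theory.
Import numFieldNormedType.Exports.
Set Implicit Arguments.
Unset Strict Implicit.
Unset Printing Implicit Defensive.
Local Open Scope classical_set_scope.
Local Open Scope ring_scope.

(* In exponential coordinates the group law of a 2-step nilpotent group is
   x y = x + y + [x, y] / 2, and the differential of the left translation by x is
   1 + ad x / 2, with inverse 1 - ad x / 2. Hence the left-invariant metric and
   complex structures have polynomial coefficients. Since j_z commutes with the
   J_i, [J_i X, J_i Y] = [X, Y], so that the J_i are integrable, and the metric
   connection with nabla_X = 0 for X in R^(4p) and nabla_z = - j_z for z in R^m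
   preserves them; its torsion is minus the three-form
   sum of z_r g(j_r X, Y) over the cyclic permutations of the arguments. All this
   is local, hence valid on any manifold whose transition maps are left
   translations, in particular on the quotient by a lattice.

   For rational parameters the lattice is c Z^n, where c is twice a common
   denominator of the entries of the j_r. Non-isometric quotients are told apart by
   their diameters: if |d phi| <= 1 then the oscillation of phi is at most twice the
   length of the longest one-parameter segment ending in the fundamental domain
   [0, c]^n, whereas (c / 2 pi) sin (2 pi x_0 / c) has oscillation c / pi. Letting
   the denominators grow fast enough yields infinitely many isometry classes. *)

(** * Calculus *)

(** Riemannian distance is not among the notions at hand. The largest oscillation of a function with
    |d phi| <= 1 stands in for the diameter: it involves differentials only and passes through an
    isometry by the chain rule. The price is analytic: smoothness is given by iterated partial
    derivatives, while the chain rule needs Fréchet differentiability, so C^1 maps have to be shown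
    differentiable.

    The geometry is reduced to matrix algebra. With [B x] the matrix of ad x, two-step nilpotency
    reads [B x *m B y = 0]; left translations become affine, and the invariant tensors are at most
    quadratic along lines.

    The quotients are separated by size alone; the local geometries of the groups are not compared.
    The two oscillation estimates differ by a factor 2 n pi, n being the dimension of the group.
    Taking t = A^-(k+1) with an integer A > 2 n pi makes the lattice scale proportional to A^(k+1),
    so distinct k are told apart. *)

Section PolynomialMaps.
Variable R : realType.

(** The difference quotient is exactly [d + h *: e]. The metric is quadratic along lines; the other
    maps treated this way are affine, with [e = 0]. *)
Lemma is_derive_expansion (V W : normedModType R) (f : V -> W) u v d e :
  (forall h : R, f (h *: v + u) = f u + h *: d + h ^+ 2 *: e) ->
  is_derive u v f d.
Proof.
move=> fE; have cv : h^-1 *: ((f \o shift u) (h *: v) - f u) @[h --> (0:R)^'] --> d.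
  have: (d + h *: e) @[h --> (0:R)^'] --> d.
    suff: (d + h *: e) @[h --> (0:R)^'] --> d + 0 *: e by rewrite scale0r addr0.
    apply: cvgD; first exact: cvg_cst.
    apply: cvgZr_tmp; apply: cvg_within_filter; exact: cvg_id.
  apply: cvg_trans; apply: near_eq_cvg.
  near=> h; have h0 : h != 0 by near: h; exact: nbhs_dnbhs_neq.
  rewrite /= fE -[f u + _ + _]addrA [f u + _]addrC addrK.
  by rewrite scalerDr !scalerA expr2 mulrA mulVf// scale1r mul1r.
apply: DeriveDef; first by apply/cvg_ex; exists d.
by apply: cvg_lim => //; exact: cv.
Unshelve. all: by end_near. Qed.

(** A syntactic class: induction shows it closed under directional derivatives, so continuity of its
    members already gives C^k for every k. *)
Inductive polymap n : ('cV[R]_n -> R) -> Prop :=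
| polymap_cst c : polymap (fun=> c)
| polymap_coord i : polymap (fun u => u i 0)
| polymap_add f g : polymap f -> polymap g -> polymap (fun u => f u + g u)
| polymap_mul f g : polymap f -> polymap g -> polymap (fun u => f u * g u).

Lemma polymap_continuous n (f : 'cV[R]_n -> R) : polymap f -> continuous f.
Proof.
elim=> [c|i|{}f g _ cf _ cg|{}f g _ cf _ cg] u.
- exact: (@cst_continuous _ _ c u).
- exact: (@coord_continuous R n 1 i 0 u).
- exact: cvgD (cf u) (cg u).
- exact: cvgM (cf u) (cg u).
Qed.

Lemma polymap_derive n (f : 'cV[R]_n -> R) (v : 'cV[R]_n) : polymap f ->
  exists2 g, polymap g & forall u, is_derive u v f (g u).
Proof.
elim=> [c|i|{}f g pf [df pdf dfE] pg [dg pdg dgE]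
    |{}f g pf [df pdf dfE] pg [dg pdg dgE]].
- by exists (fun=> 0) => [|u]; [exact: polymap_cst|exact: is_derive_cst].
- exists (fun=> v i 0) => [|u]; first exact: polymap_cst.
  apply: (@is_derive_expansion _ _ _ _ _ _ 0) => h.
  by rewrite !mxE scaler0 addr0 addrC.
- exists (fun u => df u + dg u) => [|u]; first exact: polymap_add.
  exact: is_deriveD.
- exists (fun u => f u * dg u + g u * df u) => [|u].
    by apply: polymap_add; exact: polymap_mul.
  exact: is_deriveM.
Qed.

Definition polymx n a b (f : 'cV[R]_n -> 'M[R]_(a, b)) : Prop :=
  forall i j, polymap (fun u => f u i j).

Lemma mx_continuous (T : topologicalType) a b (f : T -> 'M[R]_(a, b)) (x : T) :
  (forall i j, {for x, continuous (fun u => f u i j)}) -> {for x, continuous f}.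
Proof.
move=> cf; apply/cvgrPdist_le => /= e e0.
near=> u.
rewrite /Num.Def.normr/= mx_normrE (bigmax_le _ (ltW e0))//= => i _.
rewrite !mxE/=; move: i; near: u; apply: filter_forall => /= i.
by have /cvgrPdist_le := cf i.1 i.2; exact.
Unshelve. all: by end_near. Qed.

Lemma polymx_Ck n a b k (U : set 'cV[R]_n) (f : 'cV[R]_n -> 'M[R]_(a, b)) :
  polymx f -> Ck k U f.
Proof.
elim: k f => [|k IH] f pf; have cf u : U u -> {for u, continuous f}.
- by move=> _; apply: mx_continuous => i j; exact: polymap_continuous.
- by split.
- by move=> _; apply: mx_continuous => i j; exact: polymap_continuous.
split => // i.
have df u : derivable f u (basis_vec R i).
  apply/derivable_mxP => r c.
  have [g _ /(_ u) dg] := polymap_derive (basis_vec R i) (pf r c).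
  exact: ex_derive.
split => //; apply: IH => r c.
have [g pg dg] := polymap_derive (basis_vec R i) (pf r c).
suff -> : (fun u => 'D_(basis_vec R i) f u r c) = g by [].
by apply/funext => u; rewrite derive_mx// mxE derive_val.
Qed.

Lemma polymx_smooth n a b (U : set 'cV[R]_n) (f : 'cV[R]_n -> 'M[R]_(a, b)) :
  polymx f -> smooth U f.
Proof. by move=> pf k; exact: polymx_Ck. Qed.

Lemma polymx_continuous n a b (f : 'cV[R]_n -> 'M[R]_(a, b)) :
  polymx f -> continuous f.
Proof. by move=> pf u; apply: mx_continuous => i j; exact: polymap_continuous. Qed.

Lemma polymap_sum n (I : Type) (r : seq I) (f : I -> 'cV[R]_n -> R) :
  (forall i, polymap (f i)) -> polymap (fun u => \sum_(i <- r) f i u).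
Proof.
move=> pf; elim: r => [|i r IH].
  by under eq_fun do rewrite big_nil; exact: polymap_cst.
by under eq_fun do rewrite big_cons; exact: polymap_add.
Qed.

Section Closure.
Variables n a b : nat.
Implicit Types f g : 'cV[R]_n -> 'M[R]_(a, b).

Lemma polymx_cst (A : 'M[R]_(a, b)) : polymx (fun _ : 'cV[R]_n => A).
Proof. by move=> i j; exact: polymap_cst. Qed.

Lemma polymxD f g : polymx f -> polymx g -> polymx (fun u => f u + g u).
Proof.
by move=> pf pg i j; under eq_fun do rewrite mxE; exact: polymap_add.
Qed.

Lemma polymxZ c f : polymx f -> polymx (fun u => c *: f u).
Proof.
move=> pf i j; under eq_fun do rewrite mxE.
by apply: polymap_mul => //; exact: polymap_cst.
Qed.

Lemma polymxN f : polymx f -> polymx (fun u => - f u).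
Proof. by move=> pf; under eq_fun do rewrite -scaleN1r; exact: polymxZ. Qed.

Lemma polymxB f g : polymx f -> polymx g -> polymx (fun u => f u - g u).
Proof. by move=> pf pg; apply: polymxD => //; exact: polymxN. Qed.

Lemma polymx_tr f : polymx f -> polymx (fun u => (f u)^T).
Proof. by move=> pf i j; under eq_fun do rewrite mxE; exact: pf. Qed.

End Closure.

Lemma polymx_mul n a b c (f : 'cV[R]_n -> 'M[R]_(a, b))
  (g : 'cV[R]_n -> 'M[R]_(b, c)) :
  polymx f -> polymx g -> polymx (fun u => f u *m g u).
Proof.
move=> pf pg i j; under eq_fun do rewrite mxE.
by apply: polymap_sum => k; exact: polymap_mul.
Qed.

Lemma polymx_id n : polymx (@id 'cV[R]_n).
Proof. by move=> i j; rewrite ord1; exact: polymap_coord. Qed.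

Lemma near_eq_continuous (T S : topologicalType) (f g : T -> S) (u : T) :
  (\forall v \near u, f v = g v) -> {for u, continuous g} -> {for u, continuous f}.
Proof.
move=> fgu cg; rewrite /prop_for /continuous_at (nbhs_singleton fgu).
by apply: cvg_trans cg; apply: near_eq_cvg; apply: filterS fgu => v ->.
Qed.

(** Serves for the transition maps of a quotient, which agree with a left translation only near each
    point, the translation depending on the point. *)
Lemma Ck_local n (W : normedModType R) k (U : set 'cV[R]_n) (f : 'cV[R]_n -> W) :
  (forall u, U u -> exists2 g, Ck k setT g & \forall v \near u, f v = g v) ->
  Ck k U f.
Proof.
elim: k f => [|k IH] f fg; have cf u : U u -> {for u, continuous f}.
- by move=> /fg[g [/(_ u I) cg _] fgu]; exact: near_eq_continuous fgu cg.
- by split.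
- by move=> /fg[g [/(_ u I) cg _] fgu]; exact: near_eq_continuous fgu cg.
split => // i; split.
  move=> u /fg[g [_ /(_ i)[/(_ u I) dg _]] fgu].
  by apply: near_eq_derivable dg; apply: filterS fgu => v ->.
(* The derivatives at [v] agree only if the maps agree near [v], hence the passage to the
   interior. *)
apply: IH => u /fg[g [_ /(_ i)[_ dg]] /nbhs_interior fgu].
exists (fun u => 'D_(basis_vec R i) g u) => //.
by apply: filterS fgu => v fgv; exact: near_eq_derive.
Qed.

Lemma smooth_local n (W : normedModType R) (U : set 'cV[R]_n) (f : 'cV[R]_n -> W) :
  (forall u, U u -> exists2 g, smooth setT g & \forall v \near u, f v = g v) ->
  smooth U f.
Proof.
by move=> fg k; apply: Ck_local => u /fg[g sg fgu]; exists g.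
Qed.

End PolynomialMaps.

(** * Continuous partial derivatives imply differentiability *)

Section ContinuousPartials.
Variable R : realType.

Lemma is_derive_line (V W : normedModType R) (f : V -> W) (x v : V) (r : R) d :
  is_derive (r *: v + x) v f d -> is_derive r 1 (fun s : R => f (s *: v + x)) d.
Proof.
case=> df dE.
have E : (fun h : R => h^-1 *: (((fun s : R => f (s *: v + x)) \o shift r) (h *: 1)
           - f (r *: v + x))) =
         (fun h : R => h^-1 *: ((f \o shift (r *: v + x)) (h *: v) - f (r *: v + x))).
  by apply/funext => h /=; rewrite [_%:A]mulr1 scalerDl addrA.
by split; [rewrite /derivable E|rewrite /derive E].
Qed.

(** The mean value theorem, stated around a constant [d]: a partial derivative at the base point for
    differentiability, and 0 for a Lipschitz bound. *)
Lemma MVT_bound (phi : R -> R) (d e M a b : R) :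
  (forall r, `|r| <= M -> derivable phi r 1 /\ `|'D_1 phi r - d| <= e) ->
  `|a| <= M -> `|b| <= M ->
  `|phi b - phi a - d * (b - a)| <= e * `|b - a|.
Proof.
move=> H; wlog ab : a b / a <= b => [W aM bM|aM bM].
  have [ab|/ltW ba] := leP a b; first exact: W.
  by have := W b a ba bM aM; rewrite -normrN !opprD !opprK -mulrN opprB distrC
    [- phi a + _]addrC.
have inM r : r \in `[a, b] -> `|r| <= M.
  rewrite in_itv/= ler_norml => /andP[ar rb].
  move: aM bM; rewrite !ler_norml => /andP[Ma _] /andP[_ bM].
  by rewrite (le_trans Ma ar) (le_trans rb bM).
have [|| c cab ->] := @MVT_segment R phi (fun r => 'D_1 phi r) a b ab.
- move=> r rab; apply: derivableP; have [] := H r _ => //.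
  by apply: inM; apply: subset_itv_oo_cc rab.
- apply: derivable_within_continuous => r rab.
  by have [] := H r (inM _ rab).
- by rewrite -mulrBl normrM ler_wpM2r//; have [] := H c (inM _ cab).
Qed.

Lemma differentiable_expansion (V W : normedModType R) (f : V -> W) (u : V)
    (L : {linear V -> W}) : continuous L ->
  (forall e, 0 < e -> \forall h \near (0 : V), `|f (h + u) - f u - L h| <= e * `|h|) ->
  differentiable f u.
Proof.
move=> cL H; have E : f \o shift u = cst (f u) + L +o_ 0 id.
  apply/eqaddoP => e e0; near=> h.
  by rewrite /= !fctE opprD addrA; near: h; exact: H.
by apply/diff_locallyP; rewrite (diff_unique cL E).
Unshelve. all: by end_near. Qed.

(** The vertices of the path from 0 to [h] that moves one coordinate at a time. *)
Definition trunc_col n (k : nat) (h : 'cV[R]_n) : 'cV[R]_n :=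
  \col_i (if (i < k)%N then h i 0 else 0).

Lemma trunc_colS n (h : 'cV[R]_n) (i : 'I_n) :
  trunc_col i.+1 h = h i 0 *: basis_vec R i + trunc_col i h.
Proof.
apply/colP => r; rewrite !mxE eqxx andbT ltnS leq_eqVlt -val_eqE.
by case: (ltngtP r i) => [_|_|/val_inj ->] /=;
  rewrite ?mulr0 ?mulr1 ?add0r ?addr0.
Qed.

Lemma mx_coord_le_norm m n (A : 'M[R]_(m, n)) i j : `|A i j| <= `|A|.
Proof.
rewrite [leRHS]/Num.Def.normr/= mx_normrE.
exact: (le_bigmax _ (fun ij : 'I_m * 'I_n => `|A ij.1 ij.2|) (i, j)).
Qed.

Lemma mx_norm_leP m n (A : 'M[R]_(m, n)) (e : R) : 0 <= e ->
  (forall i j, `|A i j| <= e) -> `|A| <= e.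
Proof.
move=> e0 H; rewrite [leLHS]/Num.Def.normr/= mx_normrE.
by apply: bigmax_le.
Qed.

Lemma norm_trunc_col n (h : 'cV[R]_n) (i : 'I_n) r :
  `|r| <= `|h| -> `|r *: basis_vec R i + trunc_col i h| <= `|h|.
Proof.
move=> rh; apply: mx_norm_leP => // k l; rewrite !mxE ord1 eqxx andbT.
rewrite -val_eqE; case: (ltngtP k i) => [_|_|_] /=;
  rewrite ?mulr0 ?mulr1 ?add0r ?addr0 ?normr0 //; exact: mx_coord_le_norm.
Qed.

(** Along the path of the [trunc_col k h], each step changes [f] by the partial derivative at [u]
    times the coordinate of [h], up to [e' * |h|]; the [n] errors add up. *)
Lemma differentiable_continuous_partials n (f : 'cV[R]_n -> R) (u : 'cV[R]_n) :
  (\forall v \near u, forall i, derivable f v (basis_vec R i)) ->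
  (forall i, {for u, continuous (fun v => 'D_(basis_vec R i) f v)}) ->
  differentiable f u.
Proof.
move=> df cdf; pose L (v : 'cV[R]_n) : R := \sum_i 'D_(basis_vec R i) f u * v i 0.
have Llin : linear L.
  move=> a v w; rewrite /L scaler_sumr -big_split; apply: eq_bigr => i _ /=.
  by rewrite !mxE mulrDr /GRing.scale/= mulrCA.
have cL : continuous L.
  apply: polymap_continuous; apply: polymap_sum => i.
  by apply: polymap_mul; [exact: polymap_cst|exact: polymap_coord].
pose LM := GRing.isLinear.Build _ _ _ _ _ Llin.
pose LL : {linear 'cV[R]_n -> R} := HB.pack L LM.
apply: (@differentiable_expansion _ _ f u LL) => // e e0.
(* Dividing by [n.+1] keeps the divisor nonzero for [n = 0], and [n] such errors still sum to at
   most [e]. *)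
pose e' := e / n.+1%:R.
have e'0 : 0 < e' by rewrite divr_gt0.
have : \forall v \near u, forall i, derivable f v (basis_vec R i) /\
    `|'D_(basis_vec R i) f v - 'D_(basis_vec R i) f u| <= e'.
  near=> v; move=> i; split; first by move: i; near: v.
  move: i; near: v; apply: filter_forall => i.
  have /cvgrPdist_le/(_ _ e'0) := cdf i.
  by apply: filterS => v; rewrite distrC.
move=> /nbhs_ballP[d /= d0 Hd].
near=> h; have hd : `|h| < d.
  by near: h; exact: (@nbhs0_lt _ 'cV[R]_n).
have ballh (w : 'cV[R]_n) : `|w| <= `|h| -> ball u d (w + u).
  move=> wh; rewrite mx_norm_ball /ball_/= opprD addrCA subrr addr0 normrN.
  exact: le_lt_trans hd.
have key k : (k <= n)%N ->
    `|f (trunc_col k h + u) - f u - L (trunc_col k h)| <= k%:R * e' * `|h|.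
  elim: k => [_|k IH kn].
    have -> : trunc_col 0 h = 0 by apply/colP => i; rewrite !mxE.
    rewrite add0r subrr [L _]big1 ?subr0 ?normr0 ?mul0r// => i _.
    by rewrite mxE mulr0.
  have := @trunc_colS n h (Ordinal kn); set i := Ordinal kn => /= E.
  have hi : `|h i 0| <= `|h| by exact: mx_coord_le_norm.
  pose phi r := f (r *: basis_vec R i + (trunc_col k h + u)).
  have := @MVT_bound phi ('D_(basis_vec R i) f u) e' `|h| 0 (h i 0) _ _ hi.
  rewrite normr0 subr0 => /(_ _ (normr_ge0 h)).
  have Hphi r : `|r| <= `|h| ->
      derivable phi r 1 /\ `|'D_1 phi r - 'D_(basis_vec R i) f u| <= e'.
    move=> rh; have [|dfr le] := Hd (r *: basis_vec R i + (trunc_col k h + u)) _ i.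
      by rewrite addrA; apply: ballh; exact: (@norm_trunc_col _ _ i).
    have D := is_derive_line (derivableP dfr).
    by split; [apply: ex_derive|rewrite derive_val].
  move=> /(_ Hphi); rewrite /phi scale0r add0r => le1.
  have -> : f (trunc_col k.+1 h + u) - f u - L (trunc_col k.+1 h) =
    (f (h i 0 *: basis_vec R i + (trunc_col k h + u)) - f (trunc_col k h + u) -
       'D_(basis_vec R i) f u * h i 0) +
    (f (trunc_col k h + u) - f u - L (trunc_col k h)).
    have -> : L (trunc_col k.+1 h) =
        'D_(basis_vec R i) f u * h i 0 + L (trunc_col k h).
      rewrite E Llin; congr (_ + _); rewrite /L (bigD1 i)//= !mxE !eqxx mulr1.
      rewrite big1 ?addr0 => [|j ji]; last by rewrite mxE (negbTE ji) mulr0.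
      by rewrite /GRing.scale/= mulrC.
    rewrite E -[h i 0 *: _ + _ + u]addrA.
    have aux (a b c x y : R) : a - c - (x + y) = (a - b - x) + (b - c - y) by ring.
    exact: aux.
  apply: le_trans (ler_normD _ _) _.
  rewrite -natr1 2!mulrDl mul1r [leLHS]addrC lerD//.
    by apply: IH; exact: ltnW.
  by apply: (le_trans le1); rewrite ler_pM2l.
have := key n (leqnn n).
have -> : trunc_col n h = h by apply/colP => i; rewrite mxE ltn_ord.
move=> /le_trans; apply; rewrite ler_wpM2r// /e' mulrCA ger_pMr//.
by rewrite ler_pdivrMr// mul1r ler_nat.
Unshelve. all: by end_near. Qed.

Lemma differentiable_mx (V : normedModType R) m n (f : V -> 'M[R]_(m, n)) u :
  (forall i j, differentiable (fun v => f v i j) u) -> differentiable f u.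
Proof.
move=> df; have -> : f = \sum_i \sum_j (fun v => f v i j *: delta_mx i j).
  apply/funext => v; rewrite [LHS]matrix_sum_delta fct_sumE.
  by apply: eq_bigr => i _; rewrite fct_sumE.
apply: differentiable_sum => i; apply: differentiable_sum => j.
exact: differentiableZl.
Qed.

Lemma C1_differentiable n m (U : set 'cV[R]_n) (f : 'cV[R]_n -> 'cV[R]_m) u :
  open U -> Ck 1 U f -> U u -> differentiable f u.
Proof.
move=> oU [_ C1] Uu; apply: differentiable_mx => r c.
have dmx i : forall v, U v -> derivable f v (basis_vec R i) by have [] := C1 i.
apply: differentiable_continuous_partials => [|i].
  near=> v; move=> i; apply: (derivable_mxP f v (basis_vec R i)).1.
  by apply: dmx; near: v; exact: open_nbhs_nbhs.
have cD : {for u, continuous (fun v => 'D_(basis_vec R i) f v r c)}.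
  have [_ [/(_ u Uu) cD _]] := C1 i.
  exact: (continuous_comp cD (@coord_continuous R m 1 r c _)).
apply: near_eq_continuous cD; near=> v.
have Uv : U v by near: v; exact: open_nbhs_nbhs.
by rewrite derive_mx ?mxE//; exact: dmx.
Unshelve. all: by end_near. Qed.

End ContinuousPartials.

(** * Left-invariant geometry of 2-step nilpotent groups *)

(* Identities between matrices that are linear in the products occurring in them; *)
(* entries of the products are not expanded.                                     *)
Ltac mxring :=
  repeat (let x := fresh in move: (_ *m _) => x);
  apply/matrixP => ? ?; rewrite !mxE; ring.

Section MatrixFacts.
Variable R : realType.

Lemma mulmx_colP m n (A B : 'M[R]_(m, n)) :
  (forall x : 'cV[R]_n, A *m x = B *m x) -> A = B.
Proof.
move=> H; apply/matrixP => i j.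
by have /colP/(_ i) := H (delta_mx j 0); rewrite -!colE !mxE.
Qed.

Lemma mx11_tr (A : 'M[R]_1) : A^T = A.
Proof. by apply/matrixP => i j; rewrite !mxE !ord1. Qed.

Lemma basis_vec_sum n (v : 'cV[R]_n) : v = \sum_i v i 0 *: basis_vec R i.
Proof.
by rewrite {1}[v]matrix_sum_delta; apply: eq_bigr => i _; rewrite big_ord1.
Qed.

Lemma mulmx_basis_vec m n (A : 'M[R]_(m, n)) i r :
  (A *m basis_vec R i) r 0 = A r i.
Proof. by rewrite -colE mxE. Qed.

Lemma polymx_linear k n a b (L : {linear 'cV[R]_n -> 'M[R]_(a, b)})
    (f : 'cV[R]_k -> 'cV[R]_n) : polymx f -> polymx (fun u => L (f u)).
Proof.
move=> pf i j.
have -> : (fun u => L (f u) i j) =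
    (fun u => \sum_r f u r 0 * L (basis_vec R r) i j).
  apply/funext => u; rewrite {1}[f u]basis_vec_sum linear_sum summxE.
  by apply: eq_bigr => r _; rewrite linearZ mxE.
by apply: polymap_sum => r; apply: polymap_mul; [exact: pf|exact: polymap_cst].
Qed.

Lemma jac_near m n (f g : 'cV[R]_m -> 'cV[R]_n) u :
  (\forall v \near u, f v = g v) -> jac f u = jac g u.
Proof.
by move=> fg; apply/matrixP => i j; rewrite !mxE (near_eq_derive _ fg).
Qed.

Lemma jac_affine m n (c : 'cV[R]_n) (A : 'M[R]_(n, m)) u :
  jac (fun v => c + A *m v) u = A.
Proof.
apply/matrixP => i j; rewrite mxE.
have D : is_derive u (basis_vec R j) (fun v => c + A *m v) (A *m basis_vec R j).
  apply: (@is_derive_expansion _ _ _ _ _ _ _ 0) => h.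
  by rewrite scaler0 addr0 mulmxDr -scalemxAr -addrA [A *m u + _]addrC.
by rewrite derive_val -colE mxE.
Qed.

Lemma mul_tr_gt0 n (v : 'cV[R]_n) : v != 0 -> 0 < (v^T *m v) 0 0.
Proof.
move=> v0; have E : (v^T *m v) 0 0 = \sum_i v i 0 ^+ 2.
  by rewrite mxE; apply: eq_bigr => i _; rewrite mxE expr2.
rewrite E lt_neqAle sumr_ge0 ?andbT => [|i _]; last exact: sqr_ge0.
apply: contra_neq v0 => /esym/eqP.
rewrite psumr_eq0 => [/allP H|i _]; last exact: sqr_ge0.
apply/colP => i; rewrite mxE.
by have := H i (mem_index_enum i); rewrite /= sqrf_eq0 => /eqP.
Qed.

End MatrixFacts.

Section TwoStep.
Variables (R : realType) (n : nat).
Implicit Types u v w x y z : 'cV[R]_n.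

(* B x is the matrix of ad x. *)
Record two_step (B : {linear 'cV[R]_n -> 'M[R]_n}) : Prop := TwoStep {
  ad_anti : forall x y, B x *m y = - (B y *m x);
  ad_nil : forall x y, B x *m B y = 0 }.

Variable B : {linear 'cV[R]_n -> 'M[R]_n}.
Hypothesis B2 : two_step B.

(* frame u is the differential at 0 of the left translation by u, and coframe u  *)
(* is its inverse. They are locked because rewriting with mulmxDr and the like   *)
(* would otherwise see through them.                                             *)
Definition frame u : 'M[R]_n := locked (1%:M + 2^-1 *: B u).
Definition coframe u : 'M[R]_n := locked (1%:M - 2^-1 *: B u).

Lemma frameE u : frame u = 1%:M + 2^-1 *: B u.
Proof. by rewrite /frame -lock. Qed.

Lemma coframeE u : coframe u = 1%:M - 2^-1 *: B u.
Proof. by rewrite /coframe -lock. Qed.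

Definition ltrans a u : 'cV[R]_n := a + u + 2^-1 *: (B a *m u).

Let E := frame.
Let F := coframe.
Let BB := ad_nil B2.

(** Brackets are central: applied to [z], antisymmetry brings [B z] to the front of [B x *m y], and
    [ad_nil] applies. *)
Lemma ad_ad x y : B (B x *m y) = 0.
Proof.
apply: mulmx_colP => z.
by rewrite mul0mx (ad_anti B2) !mulmxA BB mul0mx oppr0.
Qed.

Lemma ad_frame u x : B (E u *m x) = B x.
Proof.
rewrite /E !frameE mulmxDl mul1mx -scalemxAl linearD [B (_ *: _)]linearZ /=.
by rewrite ad_ad scaler0 addr0.
Qed.

Lemma ad_coframe u x : B (F u *m x) = B x.
Proof.
rewrite /F !coframeE mulmxBl mul1mx -scalemxAl linearB [B (_ *: _)]linearZ /=.
by rewrite ad_ad scaler0 subr0.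
Qed.

Lemma ad_mul_frame u x : B x *m E u = B x.
Proof. by rewrite /E !frameE mulmxDr mulmx1 -scalemxAr BB scaler0 addr0. Qed.

Lemma ad_mul_coframe u x : B x *m F u = B x.
Proof. by rewrite /F !coframeE mulmxBr mulmx1 -scalemxAr BB scaler0 subr0. Qed.

Lemma frame_mul_ad u x : E u *m B x = B x.
Proof. by rewrite /E !frameE mulmxDl mul1mx -scalemxAl BB scaler0 addr0. Qed.

Lemma coframe_mul_ad u x : F u *m B x = B x.
Proof. by rewrite /F !coframeE mulmxBl mul1mx -scalemxAl BB scaler0 subr0. Qed.

(** [frame u] is the exponential of [B u / 2], whose series stops at the linear term; the exponents
    commute, their products being 0. *)
Lemma frameD u v : E (u + v) = E u *m E v.
Proof.
rewrite [in RHS]/E [in RHS]frameE mulmxDl mul1mx -scalemxAl ad_mul_frame.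
rewrite /E !frameE linearD.
by mxring.
Qed.

Lemma frame_ad x y : E (B x *m y) = 1%:M.
Proof. by rewrite /E !frameE ad_ad scaler0 addr0. Qed.

Lemma frameK u : E u *m F u = 1%:M.
Proof.
rewrite /E !frameE mulmxDl mul1mx -scalemxAl ad_mul_coframe.
by rewrite /F !coframeE subrK.
Qed.

Lemma coframeK u : F u *m E u = 1%:M.
Proof. exact/mulmx1C/frameK. Qed.

Lemma invmx_frame u : invmx (E u) = F u.
Proof.
have [Eu _] := mulmx1_unit (frameK u).
by rewrite -[LHS]mulmx1 -(frameK u) mulKmx.
Qed.

Lemma ltransE a u : ltrans a u = a + E a *m u.
Proof. by rewrite /ltrans /E !frameE mulmxDl mul1mx -scalemxAl addrA. Qed.

Lemma jac_ltrans a u : jac (ltrans a) u = E a.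
Proof.
have -> : ltrans a = (fun v => a + E a *m v) by apply/funext => v; exact: ltransE.
exact: jac_affine.
Qed.

(** The bracket in the product is central, hence invisible to [frame], and [frameD] does the
    rest. *)
Lemma frame_ltrans a u : E (ltrans a u) = E a *m E u.
Proof. by rewrite /ltrans !frameD scalemxAr frame_ad mulmx1. Qed.

(** Left invariance of the coframe. With [frame_ltrans] it yields the invariance of the metric, the
    complex structures and the connection. *)
Lemma coframe_ltrans a u : F (ltrans a u) *m E a = F u.
Proof.
rewrite -[LHS]mulmx1 -(frameK u) !mulmxA -[_ *m E a *m _]mulmxA.
by rewrite -frame_ltrans coframeK mul1mx.
Qed.

Lemma polymx_ad : polymx (fun u => B u).
Proof. exact: polymx_linear (@polymx_id R n). Qed.

Lemma polymx_frame : polymx E.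
Proof.
rewrite (funext frameE : E = _); apply: polymxD; first exact: polymx_cst.
exact/polymxZ/polymx_ad.
Qed.

Lemma polymx_coframe : polymx F.
Proof.
rewrite (funext coframeE : F = _); apply: polymxB; first exact: polymx_cst.
exact/polymxZ/polymx_ad.
Qed.

Lemma polymx_ltrans a : polymx (ltrans a).
Proof.
apply: polymxD; first by apply: polymxD; [exact: polymx_cst|exact: polymx_id].
by apply: polymxZ; apply: polymx_mul; [exact: polymx_cst|exact: polymx_id].
Qed.

Lemma frame_line (h : R) v u : E (h *: v + u) = E u + h *: (2^-1 *: B v).
Proof. by rewrite /E !frameE linearD [B (_ *: _)]linearZ /=; mxring. Qed.

Lemma coframe_line (h : R) v u : F (h *: v + u) = F u - h *: (2^-1 *: B v).
Proof.
by rewrite /F !coframeE linearD [B (_ *: _)]linearZ /=; mxring.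
Qed.

(* hkt_alt states that the torsion Gam y z - Gam z y - [y, z] of the            *)
(* left-invariant connection with connection form Gam is a three-form.          *)
Record hkt_data (J : 'I_3 -> 'M[R]_n) (Gam : {linear 'cV[R]_n -> 'M[R]_n}) : Prop
    := HktData {
  hkt_quat : quaternionic J;
  hkt_orth : forall i, (J i)^T *m J i = 1%:M;
  hkt_adJad : forall i x y, B x *m J i *m B y = 0;
  hkt_adJ : forall i x, B (J i *m x) *m J i = B x;
  hkt_skew : forall x, (Gam x)^T = - Gam x;
  hkt_comm : forall i x, Gam x *m J i = J i *m Gam x;
  hkt_alt : forall x y z,
    x^T *m (Gam y *m z - Gam z *m y - B y *m z) =
    - (y^T *m (Gam x *m z - Gam z *m x - B x *m z)) }.

Variables (J : 'I_3 -> 'M[R]_n) (Gam : {linear 'cV[R]_n -> 'M[R]_n}).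
Hypothesis D : hkt_data J Gam.

Definition inv_metric u : 'M[R]_n := (F u)^T *m F u.
Definition inv_cpx i u : 'M[R]_n := E u *m J i *m F u.
(* the connection for which the left-invariant frame has connection form Gam *)
Definition inv_conn u x : 'M[R]_n :=
  E u *m Gam (F u *m x) *m F u - 2^-1 *: B x.

Lemma coframe_conn u x :
  F u *m inv_conn u x = Gam (F u *m x) *m F u - 2^-1 *: B x.
Proof.
by rewrite /inv_conn mulmxBr !mulmxA coframeK mul1mx -scalemxAr coframe_mul_ad.
Qed.

Lemma conn_frame u x :
  inv_conn u x *m E u = E u *m Gam (F u *m x) - 2^-1 *: B x.
Proof.
by rewrite /inv_conn mulmxBl -!mulmxA coframeK mulmx1 -scalemxAl ad_mul_frame.
Qed.

(** This is nabla g = 0. The [Gam] terms cancel by skewness, and what remains is the linear term in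
    the expansion of the product of [coframe] with its transpose. *)
Lemma metric_derive u v :
  is_derive u v inv_metric
    ((inv_conn u v)^T *m inv_metric u + inv_metric u *m inv_conn u v).
Proof.
have -> : (inv_conn u v)^T *m inv_metric u + inv_metric u *m inv_conn u v =
   - ((2^-1 *: B v)^T *m F u + (F u)^T *m (2^-1 *: B v)).
  rewrite /inv_metric !mulmxA -trmx_mul -mulmxA coframe_conn.
  have := hkt_skew D (F u *m v); move: (F u) (2^-1 *: B v) (Gam _) => f b G GT.
  rewrite [(_ - _)^T]linearB /= trmx_mul GT mulmxBl mulmxBr mulmxN mulNmx mulmxA.
  by mxring.
apply: (@is_derive_expansion _ _ _ _ _ _ _ ((2^-1 *: B v)^T *m (2^-1 *: B v))) => h.
rewrite /inv_metric coframe_line; move: (F u) (2^-1 *: B v) => f b.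
rewrite [(_ - _)^T]linearB /= [(h *: b)^T]linearZ /=.
rewrite mulmxBl !mulmxBr -!scalemxAl -!scalemxAr.
by mxring.
Qed.

Lemma cpx_frame i u x : B x *m J i *m F u = B x *m J i.
Proof.
by rewrite /F !coframeE mulmxBr mulmx1 -scalemxAr (hkt_adJad D) scaler0 subr0.
Qed.

Lemma frame_cpx i u x : E u *m (J i *m B x) = J i *m B x.
Proof.
by rewrite /E !frameE mulmxDl mul1mx -scalemxAl mulmxA (hkt_adJad D) scaler0 addr0.
Qed.

Lemma coframe_cpx i u x : F u *m (J i *m B x) = J i *m B x.
Proof.
by rewrite /F !coframeE mulmxBl mul1mx -scalemxAl mulmxA (hkt_adJad D) scaler0 subr0.
Qed.

(** The quadratic term is a multiple of [B v *m J i *m B v], which vanishes because [J i] preserves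
    the center; so the complex structures are affine along lines. *)
Lemma cpx_line i (h : R) v u :
  inv_cpx i (h *: v + u) = inv_cpx i u + h *: (2^-1 *: (B v *m J i - J i *m B v)).
Proof.
rewrite /inv_cpx frame_line coframe_line.
have E1 := cpx_frame i u v; have E2 := frame_cpx i u v; have E3 := hkt_adJad D i v v.
move: (E u) (F u) (B v) E1 E2 E3 => e f b; rewrite mulmxA => E1 E2 E3.
rewrite !mulmxDl !mulmxBr -!scalemxAl -!scalemxAr E1 E2 E3.
by mxring.
Qed.

Lemma cpx_derive i u v :
  is_derive u v (inv_cpx i) (2^-1 *: (B v *m J i - J i *m B v)).
Proof.
apply: (@is_derive_expansion _ _ _ _ _ _ _ 0) => h.
by rewrite cpx_line scaler0 addr0.
Qed.

(** This is nabla J = 0. The [Gam] terms cancel since [Gam] commutes with [J i]; the halves of [B v]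
    in the connection cancel the derivative given by [cpx_derive]. *)
Lemma conn_cpx i u v :
  2^-1 *: (B v *m J i - J i *m B v) + inv_conn u v *m inv_cpx i u
    - inv_cpx i u *m inv_conn u v = 0.
Proof.
rewrite /inv_cpx !mulmxA conn_frame -[_ *m F u *m inv_conn u v]mulmxA coframe_conn.
have E1 := cpx_frame i u v; have E2 := frame_cpx i u v.
have E3 := hkt_comm D i (F u *m v).
move: (E u) (F u) (B v) (Gam _) E1 E2 E3 => e f b G; rewrite mulmxA => E1 E2 E3.
rewrite !mulmxBl !mulmxBr -!scalemxAl -!scalemxAr E1 E2 mulmxA -[e *m G *m _]mulmxA E3.
by rewrite !mulmxA; mxring.
Qed.

End TwoStep.

Section ModeledManifolds.
Variables (R : realType) (n : nat) (B : {linear 'cV[R]_n -> 'M[R]_n}).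
Hypothesis B2 : two_step B.
Variables (J : 'I_3 -> 'M[R]_n) (Gam : {linear 'cV[R]_n -> 'M[R]_n}).
Hypothesis D : hkt_data B J Gam.
Implicit Types (u v x y z : 'cV[R]_n) (i : 'I_3).

Let E := frame B.
Let F := coframe B.
Let W := inv_conn B Gam.
Let A := inv_cpx B J.

Lemma inv_connP u : linear (W u).
Proof.
move=> a x y; rewrite /W /inv_conn mulmxDr -scalemxAr.
rewrite [Gam (_ + _)]linearP [B (_ + _)]linearP /=.
move: (coframe B u) => f.
rewrite mulmxDr mulmxDl -scalemxAr -scalemxAl.
by mxring.
Qed.

Lemma inv_conn_sum u (c : 'cV[R]_n) :
  \sum_k c k 0 *: W u (basis_vec R k) = W u c.
Proof.
pose WM := GRing.isLinear.Build _ _ _ _ _ (inv_connP u).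
pose WL : {linear 'cV[R]_n -> 'M[R]_n} := HB.pack (W u) WM.
rewrite {2}[c]basis_vec_sum (_ : W u = WL)// linear_sum.
by apply: eq_bigr => k _; rewrite linearZ.
Qed.

(** The change of charts rule for a transition map that is affine with linear part [frame B a]: no
    inhomogeneous term occurs. *)
Lemma ltrans_conn a u x :
  W (ltrans B a u) (E a *m x) *m E a = E a *m W u x.
Proof.
rewrite /W /inv_conn mulmxBl -scalemxAl ad_frame// ad_mul_frame//.
rewrite mulmxBr -scalemxAr frame_mul_ad// frame_ltrans//.
rewrite -[_ *m F _ *m E a]mulmxA [F _ *m (E a *m x)]mulmxA !coframe_ltrans//.
by rewrite !mulmxA.
Qed.

Definition conn_torsion u x y : 'cV[R]_n := W u x *m y - W u y *m x.

(** The terms with [B x / 2] and [B y / 2] in the two connection matrices add up, by antisymmetry,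
    to the full bracket. *)
Lemma coframe_torsion u x y : F u *m conn_torsion u x y =
  Gam (F u *m x) *m (F u *m y) - Gam (F u *m y) *m (F u *m x)
    - B (F u *m x) *m (F u *m y).
Proof.
rewrite /conn_torsion mulmxBr !mulmxA !(coframe_conn B2).
rewrite !(ad_coframe B2) (ad_mul_coframe B2).
rewrite !mulmxBl -!scalemxAl (ad_anti B2 y x) scalerN opprK.
rewrite /F; move: (_ *m _ *m y) (_ *m _ *m x) (B x *m y) => p q b.
by apply/matrixP => r c; rewrite !mxE; field.
Qed.

Definition torsion_form u x y z : 'M[R]_1 :=
  x^T *m (inv_metric B u *m conn_torsion u y z).

Lemma torsion_formE u x y z : torsion_form u x y z =
  (F u *m x)^T *m (Gam (F u *m y) *m (F u *m z) - Gam (F u *m z) *m (F u *m y)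
    - B (F u *m y) *m (F u *m z)).
Proof. by rewrite -coframe_torsion trmx_mul /torsion_form /inv_metric !mulmxA. Qed.

Lemma torsion_form_alt12 u x y z : torsion_form u x y z = - torsion_form u y x z.
Proof. by rewrite !torsion_formE (hkt_alt D). Qed.

Lemma torsion_form_alt23 u x y z : torsion_form u x y z = - torsion_form u x z y.
Proof.
rewrite /torsion_form (_ : conn_torsion u y z = - conn_torsion u z y) ?mulmxN//.
by rewrite /conn_torsion opprB.
Qed.

Lemma metricJ i u : (A i u)^T *m inv_metric B u *m A i u = inv_metric B u.
Proof.
have H : F u *m A i u = J i *m F u.
  by rewrite /A /inv_cpx !mulmxA coframeK// mul1mx.
rewrite /inv_metric !mulmxA -trmx_mul -mulmxA H trmx_mul.
rewrite -!mulmxA [coframe B u *m (_ *m _)]mulmxA (coframeK B2) mul1mx.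
by rewrite [(J i)^T *m (_ *m _)]mulmxA (hkt_orth D) mul1mx.
Qed.

End ModeledManifolds.

(** * HKT structures on manifolds whose transition maps are left translations *)

Section Modeled.
Variables (R : realType) (n : nat) (B : {linear 'cV[R]_n -> 'M[R]_n}).
Hypothesis B2 : two_step B.
Variables (J : 'I_3 -> 'M[R]_n) (Gam : {linear 'cV[R]_n -> 'M[R]_n}).
Hypothesis D : hkt_data B J Gam.
Implicit Types (u v x y z : 'cV[R]_n) (i : 'I_3).

Let C i x : 'M[R]_n := 2^-1 *: (B x *m J i - J i *m B x).

Lemma cpx_column_derive i u v y :
  'D_v (fun w => inv_cpx B J i w *m y) u = C i v *m y.
Proof.
suff d : is_derive u v (fun w => inv_cpx B J i w *m y) (C i v *m y).
  by rewrite derive_val.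
apply: (@is_derive_expansion _ _ _ _ _ _ _ 0) => h.
by rewrite (cpx_line D) mulmxDl scaler0 addr0 -scalemxAl.
Qed.

Lemma ad_cpx i u x : B (inv_cpx B J i u *m x) = B (J i *m x).
Proof.
rewrite /inv_cpx -!mulmxA (ad_frame B2) coframeE mulmxBl mul1mx mulmxBr linearB /=.
rewrite -scalemxAl -scalemxAr [B (_ *: _)]linearZ /=.
have -> : B (J i *m (B u *m x)) = 0; last by rewrite scaler0 subr0.
by apply: mulmx_colP => z; rewrite (ad_anti B2) !mulmxA (hkt_adJad D) !mul0mx oppr0.
Qed.

Lemma adJ_swap i x y : B (J i *m x) *m y = - (B x *m (J i *m y)).
Proof.
rewrite -(hkt_adJ D i x); case: (hkt_quat D) => /(_ i) JJ _ _.
by rewrite -!mulmxA [J i *m (J i *m y)]mulmxA JJ mulNmx mul1mx mulmxN opprK.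
Qed.

Lemma cpx_mul_C i u x : inv_cpx B J i u *m C i x = 2^-1 *: (J i *m B x *m J i + B x).
Proof.
case: (hkt_quat D) => /(_ i) JJ _ _.
rewrite /inv_cpx /C -scalemxAr mulmxBr -!mulmxA; congr (_ *: _).
rewrite [coframe B u *m (B x *m _)]mulmxA (coframe_mul_ad B2) (coframe_cpx D).
rewrite [J i *m (J i *m _)]mulmxA JJ mulNmx mul1mx mulmxN opprK (frame_mul_ad B2).
by congr (_ + _); rewrite !mulmxA -[frame B u *m J i *m _]mulmxA (frame_cpx D).
Qed.

(** [C i v] is the derivative of the complex structure along [v], so this is the Nijenhuis tensor on
    coordinate fields. By [Jx, y] = - [x, Jy] every term reduces to [x, y], [x, Jy] or their images
    under [J i], and these cancel. *)
Lemma nijenhuis_eq0 i u x y :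
  let A := inv_cpx B J i in
  C i (A u *m x) *m y - C i (A u *m y) *m x
    + A u *m (C i y *m x) - A u *m (C i x *m y) = 0.
Proof.
move=> /=; rewrite !mulmxA !cpx_mul_C /C !ad_cpx -!scalemxAl !mulmxDl !mulNmx.
rewrite -!mulmxA !adJ_swap !(ad_anti B2 y).
case: (hkt_quat D) => /(_ i) JJ _ _.
rewrite ![J i *m (J i *m _)]mulmxA !JJ !mulNmx !mul1mx !mulmxN.
by rewrite [B (- x)]linearN /= mulNmx !adJ_swap !mulmxN; mxring.
Qed.

(** The group and its quotients are both instances. The translation is prescribed near each point
    only, since different lattice elements may occur over different parts of an overlap. *)
Record modeled (M : chartedSpace R n) (S : hyperStructure M) : Prop := Modeled {
  modeled_met : forall a, met S a = inv_metric B;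
  modeled_cpx : forall i a, cpx S i a = inv_cpx B J i;
  modeled_trans : forall a b u, ldom (@id M) a b u ->
    exists c, \forall v \near u, lmap (@id M) a b v = ltrans B c v }.

Variables (M : chartedSpace R n) (S : hyperStructure M).
Hypotheses (mM : is_manifold M) (mS : modeled S).

Lemma modeled_jac a b u : ldom (@id M) a b u ->
  exists2 c, lmap (@id M) a b u = ltrans B c u &
    \forall v \near u, jac (lmap (@id M) a b) v = frame B c.
Proof.
move=> /(modeled_trans mS)[c /nbhs_interior cu]; exists c.
  exact: (nbhs_singleton (nbhs_singleton cu)).
by apply: filterS cu => v cv; rewrite (jac_near cv) jac_ltrans.
Qed.

Lemma modeled_riemannian : riemannian_metric (met S).
Proof.
split=> [a|a b u /modeled_jac[c lc /nbhs_singleton jc]|a u _].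
- rewrite (modeled_met mS); apply: polymx_smooth.
  by apply: polymx_mul; [apply: polymx_tr|]; exact: polymx_coframe.
- rewrite !(modeled_met mS) lc jc /inv_metric !mulmxA -trmx_mul -mulmxA.
  by rewrite (coframe_ltrans B2).
- rewrite !(modeled_met mS) /inv_metric; split; first by rewrite trmx_mul trmxK.
  move=> v v0; rewrite mulmxA -trmx_mul -mulmxA; apply: mul_tr_gt0.
  apply: contra_neq v0 => Fv; rewrite -[v]mul1mx -(frameK B2 u) -mulmxA Fv.
  by rewrite mulmx0.
Qed.

Lemma modeled_endo i : endo_field (cpx S i).
Proof.
split=> [a|a b u /modeled_jac[c lc /nbhs_singleton jc]].
  rewrite (modeled_cpx mS); apply: polymx_smooth; apply: polymx_mul.
    by apply: polymx_mul; [exact: polymx_frame|exact: polymx_cst].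
  exact: polymx_coframe.
rewrite !(modeled_cpx mS) lc jc /inv_cpx -[RHS]mulmxA (coframe_ltrans B2).
by rewrite (frame_ltrans B2) !mulmxA.
Qed.

Lemma modeled_integrable i : integrable_cpx (cpx S i).
Proof.
move=> a u _ k l X Y AX AY.
rewrite /lie_bracket /AX /AY (modeled_cpx mS) !cpx_column_derive !derive_cst.
rewrite subr0 subr0 sub0r mulmxN opprK.
by rewrite subr0; exact: nijenhuis_eq0.
Qed.

Lemma inv_cpx_quaternionic u : quaternionic (fun i => inv_cpx B J i u).
Proof.
have H i k : inv_cpx B J i u *m inv_cpx B J k u =
    frame B u *m (J i *m J k) *m coframe B u.
  by rewrite /inv_cpx !mulmxA -[_ *m coframe B u *m frame B u]mulmxA
    (coframeK B2) mulmx1.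
case: (hkt_quat D) => JJ J01 J10; split=> [i||]; rewrite H ?JJ ?J01 ?J10//.
- by rewrite mulmxN mulmx1 mulNmx (frameK B2).
- by rewrite mulmxN mulNmx.
Qed.

Lemma modeled_HKT : HKT S.
Proof.
split.
  split=> //; first exact: modeled_riemannian.
  - by move=> i; split; [exact: modeled_endo|exact: modeled_integrable].
  - move=> a u _; have := inv_cpx_quaternionic u.
    by congr quaternionic; apply/funext => i; rewrite (modeled_cpx mS).
  - move=> i a u _; rewrite (modeled_cpx mS) (modeled_met mS).
    exact: (metricJ B2 D).
exists (fun a k u => inv_conn B Gam u (basis_vec R k)); split.
  split=> [a k|a b u abu k].
    apply: polymx_smooth; apply: polymxB; last exact: polymx_cst.
    apply: polymx_mul; last exact: polymx_coframe.
    apply: polymx_mul; first exact: polymx_frame.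
    apply: polymx_linear; apply: polymx_mul; last exact: polymx_cst.
    exact: polymx_coframe.
  have [c lc jc] := modeled_jac abu.
  (* The Jacobian of the transition map is constant near [u], which kills the inhomogeneous term of
     the rule. *)
  move=> phi; rewrite (near_eq_derive (g := cst (frame B c)))//.
  rewrite derive_cst add0r (nbhs_singleton jc) /phi lc.
  rewrite -(ltrans_conn B2); congr (_ *m _).
  rewrite -inv_conn_sum; apply: eq_bigr => r _.
  by rewrite mulmx_basis_vec.
move=> a u _; rewrite (modeled_met mS); split=> [k|i k|k l r].
- have dm := metric_derive B2 D u (basis_vec R k).
  exact: derive_val.
- have dc := cpx_derive D i u (basis_vec R k).
  by rewrite (modeled_cpx mS) derive_val; exact: conn_cpx.
- pose w := fun (_ : chart M) k u => inv_conn B Gam u (basis_vec R k).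
  have torsionE (y z : 'I_n) : torsion w a u y z =
      conn_torsion B Gam u (basis_vec R y) (basis_vec R z).
    apply/colP => q; rewrite mxE /conn_torsion [RHS]mxE [X in _ = _ + X]mxE.
    by rewrite !mulmx_basis_vec.
  have torsion3E (x y z : 'I_n) : torsion3 (met S) w a u x y z =
      torsion_form B Gam u (basis_vec R x) (basis_vec R y) (basis_vec R z) 0 0.
    rewrite /torsion3 (modeled_met mS) /torsion_form torsionE.
    by rewrite trmx_delta -rowE [RHS]mxE.
  rewrite !torsion3E; split.
    by rewrite (torsion_form_alt12 B2 D) mxE.
  by rewrite torsion_form_alt23 mxE.
Qed.

End Modeled.

(** * The group and its compact quotients *)

Section ChartTopology.
Variable R : realType.

Lemma chart_openE n (M : chartedSpace R n) (A : set M) : open A = chart_open A.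
Proof. by []. Qed.

(** The carrier of [euclidean] has the topology defined through its single chart, formally distinct
    from the norm topology of columns. *)
Lemma nbhs_euclidean n (x : 'cV[R]_n) :
  nbhs (x : carrier (euclidean R n)) = nbhs x.
Proof.
have oE (A : set (carrier (euclidean R n))) : open A <-> open (A : set 'cV[R]_n).
  rewrite chart_openE; split=> [/(_ tt)|oA a]; by rewrite /= setTI.
apply/seteqP; split=> A; rewrite nbhsE => -[U [oU Ux] UA].
  rewrite nbhsE; exists U => //; split=> //; exact/oE.
rewrite nbhsE; exists U => //; split=> //; exact/oE.
Qed.

Lemma euclidean_continuous m n (f : 'cV[R]_m -> 'cV[R]_n) :
  continuous f -> continuous (f : euclidean R m -> euclidean R n).
Proof.
move=> cf x A; rewrite nbhs_euclidean => nA.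
suff : nbhs (x : 'cV[R]_m) (f @^-1` A) by rewrite -nbhs_euclidean.
exact: cf nA.
Qed.

Lemma chart_coordK n (M : chartedSpace R n) (a : chart M) v :
  {in dom a &, injective (par a)} -> dom a v -> chart_coord a (par a v) = v.
Proof.
move=> inj dv; rewrite /chart_coord; case: xgetP => [w -> [dw pw]|/(_ v)[]//].
by apply: inj => //; rewrite inE.
Qed.

Lemma euclidean_coord n (y : 'cV[R]_n) a : @chart_coord R n (euclidean R n) a y = y.
Proof. exact: (@chart_coordK n (euclidean R n) a y). Qed.

Lemma euclidean_ldom n (f : euclidean R n -> euclidean R n) a b :
  ldom f a b = setT.
Proof. by apply/seteqP; split=> // u _; split=> //; exists (f u). Qed.

Lemma euclidean_lmap n (f : euclidean R n -> euclidean R n) a b :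
  lmap f a b = f.
Proof. by apply/funext => u; rewrite /lmap euclidean_coord. Qed.

Lemma ratr_near (x e : R) : 0 < e -> exists q : rat, `|x - ratr q| < e.
Proof.
move=> e0; have /rat_in_itvoo[q] : x - e < x + e by lra.
by rewrite in_itv/= => H; exists q; rewrite ltr_norml; lra.
Qed.

Lemma second_countable_cV n : @second_countable 'cV[R]_n.
Proof.
pose f (q : 'cV[rat]_n * nat) : set 'cV[R]_n :=
  ball (\col_i (ratr (q.1 i 0) : R)) (q.2.+1%:R^-1).
exists (range f).
  exact: card_le_trans (card_image_le _ _) (countableP _).
split=> [_ [q _ <-]|x A]; first exact: ball_open.
move=> /nbhs_ballP[e /= e0 eA].
have [k ke] : exists k : nat, k.+1%:R^-1 < e / 2.
  have [k] := @ltr_add_invr R 0 (e / 2) ltac:(by rewrite divr_gt0).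
    by rewrite add0r => ke; exists k.
have k0 : 0 < k.+1%:R^-1 :> R by [].
have /choice[q qx] : forall i : 'I_n, exists q : rat, `|x i 0 - ratr q| < k.+1%:R^-1.
  by move=> i; exact: ratr_near.
have xq : ball (\col_i (ratr (q i) : R)) k.+1%:R^-1 x.
  by split=> // i j; rewrite !mxE ord1 /ball/= distrC.
have fE : f (\col_i q i, k) = ball (\col_i (ratr (q i) : R)) k.+1%:R^-1.
  by rewrite /f/=; congr ball; apply/colP => i; rewrite !mxE.
exists (f (\col_i q i, k)); first by split; [exists (\col_i q i, k)|rewrite fE].
rewrite fE => y qy; apply: eA; rewrite [e]splitr.
apply: (ball_triangle (y := \col_i (ratr (q i) : R))).
  by apply: ball_sym; apply: le_ball xq; exact: ltW.
by apply: le_ball qy; exact: ltW.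
Qed.

Lemma euclidean_manifold n : is_manifold (euclidean R n).
Proof.
split.
- by move=> a u v _ _.
- by move=> y; exists tt, y.
- move=> a b; rewrite euclidean_ldom euclidean_lmap; split; first exact: openT.
  exact: polymx_smooth (@polymx_id R n).
- move=> p q; rewrite /cluster/= => pq.
  apply: (@norm_hausdorff R 'cV[R]_n) => A B pA qB.
  by apply: pq; rewrite nbhs_euclidean.
- have [C cC [Co Cb]] := second_countable_cV n; exists C => //; split.
    move=> A /Co oA; suff : @chart_open R n (euclidean R n) A by [].
    by move=> a; rewrite /= setTI.
  by move=> x; rewrite nbhs_euclidean; exact: Cb.
Qed.

End ChartTopology.

Lemma mulmx_continuous (R : realType) (T : topologicalType) a b c
    (f : T -> 'M[R]_(a, b)) (g : T -> 'M[R]_(b, c)) (x : T) :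
  {for x, continuous f} -> {for x, continuous g} ->
  {for x, continuous (fun t => f t *m g t)}.
Proof.
move=> cf cg; apply: mx_continuous => i j.
rewrite (_ : (fun u => (f u *m g u) i j) =
  (fun u => \sum_k f u i k * g u k j)); last by apply/funext => u; rewrite mxE.
elim: (index_enum _) => [|k r IH].
  rewrite (_ : (fun u => _) = cst 0); first exact: cst_continuous.
  by apply/funext => u; rewrite big_nil.
rewrite (_ : (fun u => _) = (fun u => f u i k * g u k j +
  \sum_(k <- r) f u i k * g u k j)); last by apply/funext => u; rewrite big_cons.
apply: continuousD; last exact: IH.
apply: continuousM.
  exact: (continuous_comp cf (@coord_continuous R a b i k _)).
exact: (continuous_comp cg (@coord_continuous R b c k j _)).
Qed.

(** * The Lie group and its lattices *)

Section LeftTranslations.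
Variables (R : realType) (n : nat) (B : {linear 'cV[R]_n -> 'M[R]_n}).
Hypothesis B2 : two_step B.
Implicit Types u v w x y z : 'cV[R]_n.

Lemma ad_self x : B x *m x = 0.
Proof.
have := ad_anti B2 x x; move: (B x *m x) => b bN.
by apply/colP => i; have /colP/(_ i) := bN; rewrite !mxE => ?; lra.
Qed.

Lemma ad_ltrans x y : B (ltrans B x y) = B x + B y.
Proof. by rewrite /ltrans !linearD /= linearZ /= (ad_ad B2) scaler0 addr0. Qed.

Lemma ltransA x y z : ltrans B (ltrans B x y) z = ltrans B x (ltrans B y z).
Proof.
rewrite [LHS]ltransE (frame_ltrans B2) [RHS]ltransE (ltransE B y).
by rewrite mulmxDr addrA -ltransE mulmxA.
Qed.

Lemma ltrans0 x : ltrans B x 0 = x.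
Proof. by rewrite /ltrans mulmx0 scaler0 !addr0. Qed.

Lemma ltrans0l x : ltrans B 0 x = x.
Proof. by rewrite /ltrans linear0 mul0mx scaler0 addr0 add0r. Qed.

Lemma ltransNl x : ltrans B (- x) x = 0.
Proof. by rewrite /ltrans linearN mulNmx ad_self oppr0 scaler0 addr0 addNr. Qed.

Lemma ltransNr x : ltrans B x (- x) = 0.
Proof. by rewrite /ltrans mulmxN ad_self oppr0 scaler0 addr0 addrN. Qed.

Lemma ltransKl x y : ltrans B (- x) (ltrans B x y) = y.
Proof. by rewrite -ltransA ltransNl ltrans0l. Qed.

Lemma ltransKr x y : ltrans B (ltrans B y (- x)) x = y.
Proof. by rewrite ltransA ltransNl ltrans0. Qed.

Lemma ltrans_continuous (T : topologicalType) (f g : T -> 'cV[R]_n) (t : T) :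
  {for t, continuous f} -> {for t, continuous g} ->
  {for t, continuous (fun s => ltrans B (f s) (g s))}.
Proof.
move=> cf cg; apply: continuousD; first exact: continuousD.
apply: continuousZl_tmp; apply: mulmx_continuous => //.
have cB : {for f t, continuous (fun u : 'cV[R]_n => B u)}.
  exact: (polymx_continuous (polymx_ad B)).
exact: (@continuous_comp _ _ _ f (fun u : 'cV[R]_n => B u) t cf cB).
Qed.

(** Continuity of y x^-1 with separate neighborhoods. For [P] the complement of the lattice it
    separates points of the quotient; for [P] a neighborhood of 0 meeting the lattice only in 0 it
    gives local injectivity of the projection. *)
Lemma div_near x y (P : set 'cV[R]_n) : nbhs (ltrans B y (- x)) P ->
  exists U V, [/\ nbhs x U, nbhs y V & forall u v, U u -> V v -> P (ltrans B v (- u))].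
Proof.
move=> nP.
have c : {for (x, y), continuous
    (fun p : 'cV[R]_n * 'cV[R]_n => ltrans B p.2 (- p.1))}.
  apply: ltrans_continuous; first exact: cvg_snd.
  by apply: continuousN; exact: cvg_fst.
have [[U V] /= [nU nV] UV] := c _ nP.
by exists U, V; split=> // u v Uu Vv; exact: (UV (u, v)).
Qed.

(** What the quotient asks of [Gam]: closedness makes it Hausdorff, discreteness at 0 provides
    charts, and the compact set [K] gives compactness and later the upper bound on oscillations. *)
Record lattice (Gam : set 'cV[R]_n) (K : set 'cV[R]_n) : Prop := Lattice {
  lattice0 : Gam 0;
  latticeM : forall x y, Gam x -> Gam y -> Gam (ltrans B x y);
  latticeN : forall x, Gam x -> Gam (- x);
  lattice_closed : forall x, ~ Gam x -> \forall y \near x, ~ Gam y;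
  lattice_discrete : \forall x \near (0 : 'cV[R]_n), (Gam x -> x = 0);
  lattice_compact : compact K;
  lattice_cover : forall x, exists2 c, Gam c & K (ltrans B c x) }.

Variable br : 'cV[R]_n -> 'cV[R]_n -> 'cV[R]_n.
Hypothesis brE : forall x y, br x y = B x *m y.

Definition two_step_group : groupSpace R n :=
  @GroupSpace R n (euclidean R n)
    (fun x y : 'cV[R]_n => x + y + 2^-1 *: br x y) 0 (fun x : 'cV[R]_n => - x).

Let G := two_step_group.

Lemma gmulE : @gmul R n G = ltrans B.
Proof. by apply/funext => x; apply/funext => y; rewrite /= brE. Qed.

Lemma polymx_usubmx a b : polymx (fun w : 'cV[R]_(a + b) => usubmx w).
Proof.
move=> i j; rewrite ord1.
rewrite (_ : (fun p => _) = (fun p : 'cV[R]_(a + b) => p (lshift b i) 0)).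
  exact: polymap_coord.
by apply/funext => p; rewrite mxE.
Qed.

Lemma polymx_dsubmx a b : polymx (fun w : 'cV[R]_(a + b) => dsubmx w).
Proof.
move=> i j; rewrite ord1.
rewrite (_ : (fun p => _) = (fun p : 'cV[R]_(a + b) => p (rshift a i) 0)).
  exact: polymap_coord.
by apply/funext => p; rewrite mxE.
Qed.

Lemma gmul_smooth : smooth_map2 (@gmul R n G).
Proof.
rewrite gmulE; split=> [p|a b c].
  rewrite /continuous_at nbhs_euclidean.
  have nbE : nbhs p = nbhs (p : 'cV[R]_n * 'cV[R]_n).
    by case: p => x y; rewrite /nbhs/= !nbhs_euclidean.
  rewrite nbE; apply: (@ltrans_continuous ('cV[R]_n * 'cV[R]_n)%type).
    exact: cvg_fst.
  exact: cvg_snd.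
set h := (X in smooth _ X).
have -> : h = (fun p : 'cV[R]_(n + n) => ltrans B (usubmx p) (dsubmx p)).
  by apply/funext => p; exact: euclidean_coord.
apply: polymx_smooth; apply: polymxD.
  by apply: polymxD; [exact: polymx_usubmx|exact: polymx_dsubmx].
apply: polymxZ; apply: polymx_mul; last exact: polymx_dsubmx.
by apply: polymx_linear; exact: polymx_usubmx.
Qed.

Lemma two_step_lie_group : lie_group G.
Proof.
split; first exact: euclidean_manifold.
split; first split.
- by move=> x y z; rewrite gmulE ltransA.
- by move=> x; rewrite gmulE ltrans0l.
- by move=> x; rewrite gmulE ltransNl.
split; first exact: gmul_smooth.
split=> [|a b].
  exact/euclidean_continuous/(polymx_continuous (polymxN (@polymx_id R n))).
rewrite (euclidean_lmap (fun x : 'cV[R]_n => - x) a b).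
by apply: polymx_smooth; apply: polymxN; exact: polymx_id.
Qed.

(** In exponential coordinates the group commutator is exactly the bracket, so a double commutator
    is a double bracket. *)
Lemma two_step_nilpotent : nilpotent_group G.
Proof.
have cE (u v : 'cV[R]_n) : @gcomm R n G u v = B u *m v :> 'cV[R]_n.
  rewrite /gcomm gmulE [ginv _]/= {1}/ltrans ad_ltrans.
  rewrite !linearN /= -opprD -linearD /= mulNmx.
  rewrite {3}/ltrans mulmxDr ad_self add0r -scalemxAr mulmxA (ad_nil B2) mul0mx.
  rewrite scaler0 oppr0 scaler0 addr0 /ltrans [B (- u)]linearN mulNmx mulmxN opprK.
  by move: (B u *m v) => b; apply/matrixP => r c; rewrite !mxE; field.
exists 2%N; apply/seteqP; split=> // x _ y z.
suff : @gcomm R n G (@gcomm R n G x y) z = 0 :> 'cV[R]_n by [].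
by rewrite cE (_ : B _ = B (B x *m y)) ?cE// (ad_ad B2) mul0mx.
Qed.

End LeftTranslations.

(** * The quotient by a lattice *)

Section Quotient.
Variables (R : realType) (n : nat) (B : {linear 'cV[R]_n -> 'M[R]_n}).
Hypothesis B2 : two_step B.
Implicit Types u v w x y z : 'cV[R]_n.
Variable br : 'cV[R]_n -> 'cV[R]_n -> 'cV[R]_n.
Hypothesis brE : forall x y, br x y = B x *m y.
Variables Gam K : set 'cV[R]_n.
Hypothesis L : lattice B Gam K.

Let G := two_step_group br.
Let Q := @quotient_space R n G Gam.
Let pr (x : 'cV[R]_n) : Q := @qproj R n G Gam x.

(** Cosets have the form Gam x, so points are identified by left translations, under which
    left-invariant tensors descend. *)
Lemma qproj_eq x y : pr x = pr y <-> exists2 c, Gam c & y = ltrans B c x.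
Proof.
split=> [[] /seteqP[_]|[c gc ->]].
  have : @gcoset R n G Gam y y.
    by exists 0; [exact: lattice0 L|rewrite (gmulE brE) ltrans0l].
  by move=> gy /(_ _ gy)[c gc <-]; exists c => //; rewrite -(gmulE brE).
apply: eq_exist; rewrite /gcoset (gmulE brE); apply/seteqP; split=> z [d gd <-].
  exists (ltrans B d (- c)); first by apply: (latticeM L) => //; exact: (latticeN L).
  by rewrite -(ltransA B2) (ltransKr B2).
exists (ltrans B d c); first exact: (latticeM L).
by rewrite (ltransA B2).
Qed.

Lemma qproj_surj (q : Q) : exists x, q = pr x.
Proof. by case: q => A [x Ax]; exists x; exact: eq_exist. Qed.

Lemma ltrans_cont c : continuous (ltrans B c).
Proof. exact: polymx_continuous (polymx_ltrans B c). Qed.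

Lemma qproj_locally_injective x :
  exists U, [/\ open U, U x & forall u v, U u -> U v -> pr u = pr v -> u = v].
Proof.
have := lattice_discrete L; rewrite -{1}(ltransNr B2 x).
move=> /(div_near (B:=B))[U [V [nU nV UV]]].
have : nbhs x (U `&` V) by exact: filterI.
rewrite nbhsE => -[W [oW Wx] WUV]; exists W; split=> // u v Wu Wv.
move=> /qproj_eq[c gc vE]; have [_ Vv] := WUV _ Wv; have [Uu _] := WUV _ Wu.
have cE : c = ltrans B v (- u) by rewrite vE (ltransA B2) (ltransNr B2) ltrans0.
by have := UV u v Uu Vv; rewrite -cE => /(_ gc) c0; rewrite vE c0 ltrans0l.
Qed.

Lemma qchart_at x : exists a : chart Q, dom a x.
Proof.
have [U [oU Ux injU]] := qproj_locally_injective x.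
have H : [/\ open U, U `<=` @dom R n G tt &
    {in U &, injective (@qproj R n G Gam \o @par R n G tt)}].
  by split=> // u v; rewrite !inE => Uu Uv; exact: injU.
by exists (exist _ (tt, U) H).
Qed.

Lemma par_quotient (a : chart Q) : par a = pr.
Proof. by case: a => -[[] U]. Qed.

Lemma quotient_inj (a : chart Q) : {in dom a &, injective (par a)}.
Proof. by case: a => -[a U] []. Qed.

(** The chart topology is the quotient topology: all charts are restrictions of the one projection
    [pr], and their domains cover the group. *)
Lemma open_quotient (A : set Q) : open A <-> open (pr @^-1` A).
Proof.
rewrite chart_openE; split=> [oA|oA a]; last first.
  by rewrite par_quotient; apply: openI => //; exact: dom_open.
rewrite openE => x Ax; have [a ax] := qchart_at x.
have := oA a; rewrite par_quotient openE => /(_ x (conj ax Ax)).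
by apply: filterS => y [].
Qed.

Lemma qproj_open U : open U -> open (pr @` U).
Proof.
move=> oU; apply/open_quotient; rewrite openE => x [u Uu /qproj_eq[c gc xE]].
have : nbhs x (ltrans B (- c) @^-1` U).
  apply: ltrans_cont; rewrite xE (ltransKl B2); exact: open_nbhs_nbhs.
apply: filterS => y Uy; exists (ltrans B (- c) y) => //.
apply/qproj_eq; exists c => //.
by rewrite -(ltransA B2) (ltransNr B2) ltrans0l.
Qed.

Lemma qproj_continuous : continuous (pr : 'cV[R]_n -> Q).
Proof. by apply/continuousP => A /open_quotient. Qed.

(** The lattice element that carries [u] into [dom b] still does so for nearby points, by
    continuity, and injectivity on [dom b] leaves no other value for the transition map. *)
Lemma quotient_trans (a b : chart Q) u : ldom (@id Q) a b u ->
  exists c, \forall v \near u, dom b (ltrans B c v) /\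
    lmap (@id Q) a b v = ltrans B c v.
Proof.
case=> du [v dv]; rewrite !par_quotient => /esym/qproj_eq[c gc vE].
exists c; have : nbhs u (ltrans B c @^-1` dom b).
  apply: ltrans_cont; rewrite -vE; apply: open_nbhs_nbhs.
  by split=> //; exact: dom_open.
apply: filterS => w dw; split => //; rewrite /lmap.
have -> : par a w = par b (ltrans B c w).
  by rewrite !par_quotient; apply/qproj_eq; exists c.
exact: chart_coordK (@quotient_inj b) dw.
Qed.

(** If y x^-1 is not in the closed set [Gam], neither is v u^-1 for [u], [v] near [x], [y]; the
    images of these neighborhoods are then disjoint. *)
Lemma quotient_hausdorff : hausdorff_space (carrier Q).
Proof.
move=> p q; have [x ->] := qproj_surj p; have [y ->] := qproj_surj q.
move=> pq.
apply/qproj_eq; apply: contrapT => N.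
have {}N : ~ Gam (ltrans B y (- x)).
  by move=> g; apply: N; exists (ltrans B y (- x)) => //; rewrite (ltransKr B2).
have [U [V [nU nV UV]]] := div_near (lattice_closed L N).
have nb z (W : set 'cV[R]_n) : nbhs z W -> nbhs (pr z) (pr @` W).
  rewrite nbhsE => -[W' [oW Wz] WW]; rewrite nbhsE; exists (pr @` W').
    by split; [exact: qproj_open|exists z].
  by move=> _ [w Ww <-]; exists w => //; exact: WW.
have [_ [[u Uu <-] [v Vv /qproj_eq[c gc uE]]]] := pq _ _ (nb _ _ nU) (nb _ _ nV).
apply: (UV u v Uu Vv).
have -> : v = ltrans B (- c) u by rewrite uE (ltransKl B2).
rewrite (ltransA B2) (ltransNr B2) ltrans0.
exact: latticeN L _ gc.
Qed.

Lemma quotient_second_countable : @second_countable (carrier Q).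
Proof.
have [C cC [Co Cb]] := second_countable_cV R n.
exists ((fun U => pr @` U) @` C); first exact: card_le_trans (card_image_le _ _) cC.
split=> [_ [U CU <-]|q A]; first by apply: qproj_open; exact: Co.
have [x ->] := qproj_surj q; move=> qA.
have nA : nbhs x (pr @^-1` A) := qproj_continuous qA.
have [U [CU Ux] UA] := Cb x _ nA; exists (pr @` U).
  by split; [exists U|exists x].
by move=> _ [u Uu <-]; exact: UA.
Qed.

Lemma quotient_manifold : is_manifold Q.
Proof.
split; [exact: quotient_inj| |move=> a b|exact: quotient_hausdorff
  |exact: quotient_second_countable].
  move=> q; have [x ->] := qproj_surj q; have [a ax] := qchart_at x.
  by exists a, x => //; rewrite par_quotient.
split.
  have -> : ldom (@id Q) a b = dom a `&` pr @^-1` (pr @` dom b).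
    by apply/seteqP; split=> u; rewrite /ldom/= /pimage !par_quotient.
  by apply: openI; [exact: dom_open|apply/open_quotient/qproj_open/dom_open].
apply: smooth_local => u /quotient_trans[c cE]; exists (ltrans B c).
  exact: polymx_smooth (polymx_ltrans B c).
by apply: filterS cE => v [].
Qed.

Lemma quotient_compact : compact [set: carrier Q].
Proof.
have -> : [set: carrier Q] = pr @` K.
  apply/seteqP; split=> // q _; have [x ->] := qproj_surj q.
  have [c gc Kc] := lattice_cover L x; exists (ltrans B c x) => //.
  by apply/esym/qproj_eq; exists c.
apply: continuous_compact (lattice_compact L).
exact/continuous_subspaceT/qproj_continuous.
Qed.

Lemma lattice_isolated x : Gam x -> \forall v \near x, (Gam v -> v = x).
Proof.
move=> gx; have := lattice_discrete L; rewrite -{1}(ltransNr B2 x) => nx.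
have c : {for x, continuous (fun v => ltrans B v (- x))}.
  by apply: ltrans_continuous; [exact: cvg_id|exact: cst_continuous].
have : nbhs x [set v | Gam (ltrans B v (- x)) -> ltrans B v (- x) = 0] by exact: c nx.
apply: filterS => v H gv.
have E : ltrans B v (- x) = 0.
  by apply: H; apply: (latticeM L) => //; exact: (latticeN L).
by rewrite -(ltransKr B2 x v) E ltrans0l.
Qed.

Lemma lattice_subgroup : @discrete_subgroup R n G Gam.
Proof.
split; [exact: lattice0 L| |exact: latticeN L|move=> x gx].
  by move=> x y gx gy; rewrite (gmulE brE); exact: (latticeM L gx gy).
split; first by rewrite inE.
exists [set v | Gam v -> v = x].
  by rewrite nbhs_euclidean; exact: lattice_isolated.
by apply/seteqP; split=> [v [H /H]|_ ->].
Qed.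

Variables (J : 'I_3 -> 'M[R]_n) (Ga : {linear 'cV[R]_n -> 'M[R]_n}).
Hypothesis D : hkt_data B J Ga.

(** Spelled with [jac] and [invmx], so that [nil_structure] is an instance by conversion. *)
Definition left_invariant : hyperStructure G :=
  @HyperStructure R n G
    (fun _ x => (invmx (@jac R n n (@gmul R n G x) 0))^T
                  *m invmx (@jac R n n (@gmul R n G x) 0))
    (fun i _ x => @jac R n n (@gmul R n G x) 0 *m J i
                    *m invmx (@jac R n n (@gmul R n G x) 0)).

Lemma jac_gmul u : @jac R n n (@gmul R n G u) 0 = frame B u.
Proof. by rewrite (gmulE brE) jac_ltrans. Qed.

Lemma left_invariant_met a : met left_invariant a = inv_metric B.
Proof.
apply/funext => u; transitivity ((invmx (@jac R n n (@gmul R n G u) 0))^T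
  *m invmx (@jac R n n (@gmul R n G u) 0)) => //.
by rewrite jac_gmul (invmx_frame B2).
Qed.

Lemma left_invariant_cpx i a : cpx left_invariant i a = inv_cpx B J i.
Proof.
apply/funext => u; transitivity (@jac R n n (@gmul R n G u) 0 *m J i
  *m invmx (@jac R n n (@gmul R n G u) 0)) => //.
by rewrite jac_gmul (invmx_frame B2).
Qed.

Lemma left_invariant_HKT : HKT left_invariant.
Proof.
apply: (modeled_HKT B2 D); first exact: euclidean_manifold.
split; [exact: left_invariant_met|exact: left_invariant_cpx|].
move=> a b u _; exists 0; apply: (@filterE _ (nbhs (u : 'cV[R]_n))) => v.
by rewrite ltrans0l; exact: euclidean_coord.
Qed.

Lemma left_invariant_homogeneous : homogeneous left_invariant.
Proof.
exists n, G, (@gmul R n G); split.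
- exact: (two_step_lie_group B2 brE).
- exact: (gmul_smooth brE).
- by rewrite (gmulE brE); split; [exact: ltrans0l|move=> *; exact: (ltransA B2)].
- move=> x y; exists (ltrans B y (- x)).
  by rewrite (gmulE brE) (ltransKr B2).
move=> c; rewrite (gmulE brE).
have lE a b : @lmap R n n G G (ltrans B c) a b = ltrans B c.
  exact: euclidean_lmap.
split=> [|i] a b u _; rewrite lE jac_ltrans.
  rewrite !left_invariant_met /inv_metric !mulmxA -trmx_mul -mulmxA.
  by rewrite (coframe_ltrans B2).
rewrite !left_invariant_cpx /inv_cpx -[RHS]mulmxA (coframe_ltrans B2).
by rewrite (frame_ltrans B2) !mulmxA.
Qed.

Lemma quotient_HKT_nilmanifold : HKT_nilmanifold left_invariant Gam.
Proof.
split; [exact: (two_step_lie_group B2 brE)|exact: (two_step_nilpotent B2 brE)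
  |exact: lattice_subgroup|exact: quotient_compact|].
apply: (modeled_HKT B2 D); first exact: quotient_manifold.
split=> [a|i a|a b u /quotient_trans[c cE]].
- exact: left_invariant_met.
- exact: left_invariant_cpx.
- by exists c; apply: filterS cE => v [].
Qed.

End Quotient.

(** * Isometries between quotients *)

Section Contractions.
Variable R : realType.

Lemma near_eq_differentiable (V W : normedModType R) (f g : V -> W) (x : V) :
  (\forall y \near x, f y = g y) -> differentiable g x -> differentiable f x.
Proof.
move=> fg dg; apply: (@differentiable_expansion _ _ _ f x ('d g x)) => [|e e0].
  exact: diff_continuous.
have := diff_locally dg => /eqaddoP/(_ e e0) H.
near=> h; rewrite (nbhs_singleton fg).
have -> : f (h + x) = g (h + x).
  near: h; have c : {for (0 : V), continuous (fun h : V => h + x)}.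
    by apply: continuousD; [exact: cvg_id|exact: cst_continuous].
  have fg0 : nbhs (0 + x) (fun y => f y = g y) by rewrite add0r.
  exact: (c _ fg0).
have : `|((g \o shift x) - (cst (g x) + 'd g x)) h| <= e * `|h| by near: h.
by rewrite /= !fctE /= opprD addrA.
Unshelve. all: by end_near. Qed.

Lemma diff_jac m n (f : 'cV[R]_m -> 'cV[R]_n) u v :
  differentiable f u -> 'd f u v = jac f u *m v.
Proof.
move=> df; rewrite {1}[v]basis_vec_sum linear_sum; apply/colP => k.
rewrite summxE mxE; apply: eq_bigr => i _.
by rewrite linearZ !mxE deriveE// mulrC.
Qed.

Lemma par_chart_coord n (M : chartedSpace R n) (a : chart M) y :
  pimage a y -> dom a (chart_coord a y) /\ par a (chart_coord a y) = y.
Proof.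
by case=> v dv vy; rewrite /chart_coord; case: xgetP => [w -> //|/(_ v)[]].
Qed.

Lemma smooth_ldom_open m n (M : chartedSpace R m) (N : chartedSpace R n)
    (f : M -> N) a b : is_manifold N -> smooth_map f -> open (ldom f a b).
Proof.
case=> _ _ trN _ _ [/continuousP cf _].
have ob : open (pimage b : set N).
  by rewrite chart_openE => a'; have [] := trN a' b.
have := cf _ ob; rewrite chart_openE => /(_ a).
by congr open.
Qed.

Lemma smooth_lmap_differentiable m n (M : chartedSpace R m) (N : chartedSpace R n)
    (f : M -> N) a b u : is_manifold N -> smooth_map f -> ldom f a b u ->
  differentiable (lmap f a b) u.
Proof.
move=> mN sf du; have C1 : Ck 1 (ldom f a b) (lmap f a b) by have [_ /(_ a b 1%N)] := sf.
exact: (C1_differentiable (@smooth_ldom_open _ _ _ _ _ a b mN sf) C1 du).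
Qed.

(* |d phi|_g <= 1 everywhere *)
Definition contraction n (M : chartedSpace R n) (g : tensor_field M 'M[R]_n)
    (phi : M -> R) : Prop :=
  forall a u, dom a u -> differentiable (phi \o par a) u /\
    forall v, ('D_v (phi \o par a) u) ^+ 2 <= (v^T *m g a u *m v) 0 0.

(** By the chain rule, |d(phi o f) v| = |d phi (df v)| <= |df v|_h = |v|_g. *)
Lemma contraction_comp m n (M : chartedSpace R m) (N : chartedSpace R n)
    (f : M -> N) g h (phi : N -> R) : is_manifold N -> smooth_map f ->
  pulls_metric f g h -> contraction h phi -> contraction g (phi \o f).
Proof.
move=> mN sf fgh cphi a u du.
have [_ /(_ (f (par a u)))[b fb] _ _ _] := mN.
have lu : ldom f a b u by [].
have [dL eL] := par_chart_coord fb.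
have [dphi le_phi] := cphi b _ dL.
have dl := smooth_lmap_differentiable mN sf lu.
have E : \forall v \near u, (phi \o f \o par a) v = ((phi \o par b) \o lmap f a b) v.
  have := open_nbhs_nbhs (conj (@smooth_ldom_open _ _ _ _ _ a b mN sf) lu).
  by apply: filterS => v [_ /par_chart_coord[_ ev]]; rewrite /lmap/= ev.
have dc : differentiable ((phi \o par b) \o lmap f a b) u.
  exact: differentiable_comp.
split=> [|v]; first exact: (near_eq_differentiable E dc).
rewrite (near_eq_derive _ E) deriveE// diff_comp//= diff_jac//.
rewrite -deriveE//; apply: le_trans (le_phi _) _.
by rewrite (fgh a b u lu) trmx_mul !mulmxA.
Qed.

(** The Jacobians of [f] and [f'] in charts are inverse to each other by the chain rule, so the
    formula for [f] can be solved for [h]. *)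
Lemma pulls_metric_inverse n (M N : chartedSpace R n) (f : M -> N) (f' : N -> M) g h :
  is_manifold M -> is_manifold N -> cancel f f' -> cancel f' f ->
  smooth_map f -> smooth_map f' -> pulls_metric f g h -> pulls_metric f' h g.
Proof.
move=> mM mN fK f'K sf sf' fgh b a w [dw pw].
set u := lmap f' b a w.
have [du eu] := par_chart_coord pw.
have lu : ldom f a b u by split => //; rewrite eu f'K; exists w.
have injb : {in dom b &, injective (par b)} by case: mN.
have ew : lmap f a b u = w by rewrite /lmap eu f'K chart_coordK.
have lw : ldom f' b a w by [].
have d1 := smooth_lmap_differentiable mN sf lu.
have d2 := smooth_lmap_differentiable mM sf' lw.
have J1 : jac (lmap f a b) u *m jac (lmap f' b a) w = 1%:M.
  apply: mulmx_colP => v; rewrite -mulmxA mul1mx -(diff_jac _ d2) -(diff_jac _ d1).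
  rewrite -[LHS]/(('d (lmap f a b) u \o 'd (lmap f' b a) w) v) -diff_comp//.
  have E : \forall x \near w, (lmap f a b \o lmap f' b a) x = id x.
    have := open_nbhs_nbhs (conj (@smooth_ldom_open _ _ _ _ _ b a mM sf') lw).
    apply: filterS => x [dx px]; rewrite /lmap/=.
    by have [_ ->] := par_chart_coord px; rewrite f'K chart_coordK.
  have dc : differentiable (lmap f a b \o lmap f' b a) w by exact: differentiable_comp.
  by rewrite -deriveE// (near_eq_derive _ E) derive_id.
rewrite (fgh a b u lu) ew !mulmxA -trmx_mul -!mulmxA J1 trmx1 mul1mx.
by rewrite mulmx1.
Qed.

Lemma isometric_sym n (M N : chartedSpace R n) g h :
  is_manifold M -> is_manifold N ->
  @isometric R n n M g N h -> @isometric R n n N h M g.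
Proof.
move=> mM mN [f [f' [fK f'K sf sf' fgh]]].
by exists f', f; split=> //; exact: (pulls_metric_inverse mM mN fK f'K sf sf' fgh).
Qed.

Lemma isometric_oscillation n (M N : chartedSpace R n) g h (r : R) (psi : N -> R) p q :
  is_manifold N -> @isometric R n n M g N h ->
  (forall phi, contraction g phi -> forall x y, phi x - phi y <= r) ->
  contraction h psi -> psi p - psi q <= r.
Proof.
move=> mN [f [f' [fK f'K sf sf' fgh]]] osc cpsi.
by have := osc _ (contraction_comp mN sf fgh cpsi) (f' p) (f' q); rewrite /= !f'K.
Qed.

End Contractions.

(** * Upper and lower bounds for the oscillation of contractions on a quotient *)

Section QuotientOscillation.
Variables (R : realType) (n : nat) (B : {linear 'cV[R]_n -> 'M[R]_n}).
Hypothesis B2 : two_step B.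
Variable br : 'cV[R]_n -> 'cV[R]_n -> 'cV[R]_n.
Hypothesis brE : forall x y, br x y = B x *m y.
Variables Gam K : set 'cV[R]_n.
Hypothesis L : lattice B Gam K.
Implicit Types u v x y : 'cV[R]_n.

Let G := two_step_group br.
Let Q := @quotient_space R n G Gam.
Let pr (x : 'cV[R]_n) : Q := @qproj R n G Gam x.
Let g : tensor_field Q 'M[R]_n := fun _ => inv_metric B.

Lemma contraction_qproj (phi : Q -> R) : contraction g phi -> forall x,
  differentiable (phi \o pr) x /\
  forall v, ('D_v (phi \o pr) x) ^+ 2 <= (v^T *m inv_metric B x *m v) 0 0.
Proof.
move=> cphi x; have [a ax] := qchart_at B2 brE L x.
by have := cphi a x ax; rewrite par_quotient.
Qed.

Lemma contraction_qproj_le (phi : Q -> R) (r : R) x : 0 <= r ->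
  contraction g phi -> (x^T *m x) 0 0 <= r ^+ 2 ->
  `|phi (pr x) - phi (pr 0)| <= r.
Proof.
move=> r0 cphi xr; have cq := contraction_qproj cphi.
pose f s := (phi \o pr) (s *: x + 0).
have Hf s : `|s| <= 1 -> derivable f s 1 /\ `|'D_1 f s - 0| <= r.
  move=> _; have [df le_f] := cq (s *: x + 0).
  have D := is_derive_line (derivableP (diff_derivable (v := x) df)).
  split; first exact: ex_derive.
  rewrite subr0 derive_val -ler_sqr ?nnegrE// -normrX ger0_norm ?sqr_ge0//.
  apply: le_trans (le_f x) _; rewrite addr0 /inv_metric !mulmxA -trmx_mul -mulmxA.
  (* The segment s x is a one-parameter subgroup: as [x, x] = 0, its velocity has constant invariant
     length |x|. *)
  have -> : coframe B (s *: x) *m x = x; last by [].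
  rewrite coframeE mulmxBl mul1mx linearZ /= -!scalemxAl (ad_self B2).
  by rewrite !scaler0 subr0.
have := MVT_bound Hf; move=> /(_ 0 1); rewrite normr0 normr1 ler01 lexx.
move=> /(_ isT isT); rewrite mul0r subr0 subr0 normr1 mulr1.
by rewrite /f scale1r scale0r !addr0.
Qed.

(** Every point has a representative in [K]; comparing both points with the class of 0 costs the
    factor 2. *)
Lemma quotient_oscillation (r : R) : 0 <= r ->
  (forall x, K x -> (x^T *m x) 0 0 <= r ^+ 2) ->
  forall phi, contraction g phi -> forall p q, phi p - phi q <= 2 * r.
Proof.
move=> r0 Kr phi cphi p q.
have H p' : `|phi p' - phi (pr 0)| <= r.
  have [x ->] := qproj_surj p'; have [c gc Kc] := lattice_cover L x.
  have -> : @qproj R n G Gam x = pr (ltrans B c x).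
    by apply/(qproj_eq B2 brE L); exists c.
  by apply: contraction_qproj_le => //; exact: Kr.
have := H p; have := H q; rewrite !ler_norml => /andP[? ?] /andP[? ?]; lra.
Qed.

Variables (i0 : 'I_n) (c : R).
Hypothesis c0 : 0 < c.
Hypothesis ad_i0 : forall x y, (B x *m y) i0 0 = 0.
Hypothesis Gam_i0 : forall x, Gam x -> exists k : int, x i0 0 = c * k%:~R.

Let wave (s : R) : R := c / (2 * pi) * sin (2 * pi / c * s).

Lemma sin_intmul (x : R) (k : int) : sin (x + k%:~R * (2 * pi)) = sin x.
Proof.
have H (y : R) (m : nat) : sin (y + m%:R * (2 * pi)) = sin y.
  by rewrite !mulr_natl (periodicn (@sinD2pi R)).
case: k => m; first exact: H.
by rewrite NegzE mulrNz mulNr -(H (x - _) m.+1) subrK.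
Qed.

Lemma wave_derive (s : R) : is_derive s 1 wave (cos (2 * pi / c * s)).
Proof.
have pi0 := pi_gt0 R.
have d1 : is_derive s 1 (fun t : R => 2 * pi / c * t) (2 * pi / c).
  apply: (@is_derive_expansion _ _ _ _ _ _ _ 0) => h.
  by rewrite scaler0 addr0 /GRing.scale/= mulr1 mulrDr addrC [h * _]mulrC.
have d2 := is_derive1_comp (is_derive_sin (2 * pi / c * s)) d1.
have d3 := is_deriveZ (c / (2 * pi)) d2.
apply: (is_derive_eq d3); rewrite /GRing.scale/=.
move: (cos _) => a; move: (@pi R) pi0 => p p0; field.
by rewrite !gt_eqF.
Qed.

Lemma wave_oscillation : wave (c / 4) - wave (- (c / 4)) = c / pi.
Proof.
have pi0 := pi_gt0 R.
have -> : wave (- (c / 4)) = - wave (c / 4) by rewrite /wave mulrN sinN mulrN.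
have -> : wave (c / 4) = c / (2 * pi); last first.
  by move: (@pi R) pi0 => p p0; field; rewrite gt_eqF.
rewrite /wave (_ : 2 * pi / c * (c / 4) = pi / 2); first by rewrite sin_pihalf mulr1.
by move: (@pi R) pi0 => p p0; field; rewrite gt_eqF.
Qed.

(** Brackets have no component along [i0], so this coordinate is a homomorphism to R that sends
    [Gam] into c Z, and [wave], of period [c], descends. Its derivative is a cosine, and [coframe]
    preserves the coordinate, so the slope is at most 1. The extremes are at c/4 and - c/4. *)
Lemma quotient_wave : exists psi : Q -> R,
  contraction g psi /\ exists p q, psi p - psi q = c / pi.
Proof.
pose rep (q : Q) : 'cV[R]_n := sval (cid (qproj_surj q)).
have repE q : pr (rep q) = q by rewrite /rep; case: cid.
pose psi q := wave (rep q i0 0).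
have psiE x : psi (pr x) = wave (x i0 0).
  have /(qproj_eq B2 brE L)[d gd xE] := repE (pr x).
  have -> : x i0 0 = d i0 0 + rep (pr x) i0 0.
    rewrite {1}xE /ltrans mxE [X in X + _]mxE [X in _ + X]mxE ad_i0.
    by rewrite mulr0 addr0.
  have [k ->] := Gam_i0 gd; rewrite /psi /wave; congr (_ * _).
  rewrite -(sin_intmul _ k); congr sin.
  by move: (rep _ _ _) (@pi R) => a p; field; rewrite gt_eqF.
exists psi; split; last first.
  exists (pr (\col_i (c / 4))), (pr (\col_i (- (c / 4)))).
  by rewrite !psiE !mxE wave_oscillation.
move=> a u _; rewrite par_quotient.
have -> : psi \o @qproj R n G Gam = wave \o (fun x : 'cV[R]_n => x i0 0).
  by apply/funext => x; exact: psiE.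
have dco : differentiable (fun x : 'cV[R]_n => x i0 0) u.
  exact: differentiable_coord.
have dw : differentiable wave (u i0 0).
  apply/derivable1_diffP; exact: (@ex_derive _ _ _ _ _ _ _ (wave_derive _)).
have dc := differentiable_comp dco dw.
split=> // v; rewrite deriveE// diff_comp//=.
rewrite -!deriveE//.
have -> : 'D_v (fun x : 'cV[R]_n => x i0 0) u = v i0 0.
  suff d : is_derive u v (fun x : 'cV[R]_n => x i0 0) (v i0 0) by rewrite derive_val.
  apply: (@is_derive_expansion _ _ _ _ _ _ _ 0) => h.
  by rewrite !mxE scaler0 addr0 addrC.
rewrite deriveE// diff1E// derive1E /GRing.scale/=.
have dwv := wave_derive (u i0 0); rewrite derive_val.
have Fi : (coframe B u *m v) i0 0 = v i0 0.
  rewrite coframeE mulmxBl mul1mx -scalemxAl mxE [X in _ + X]mxE [X in - X]mxE.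
  by rewrite ad_i0 mulr0 oppr0 addr0.
rewrite /inv_metric !mulmxA -trmx_mul -mulmxA mxE (bigD1 i0)//=.
rewrite mxE Fi exprMn -expr2.
apply: (@le_trans _ _ (v i0 0 ^+ 2)).
  rewrite ler_piMr ?sqr_ge0// -[leRHS](cos2Dsin2 (2 * pi / c * u i0 0)).
rewrite lerDl sumr_ge0// => k _; rewrite mxE -expr2; exact: sqr_ge0.
Qed.

End QuotientOscillation.

(** * Lattices of integer points in exponential coordinates; [Z] marks the central coordinates *)

Section IntegerLattice.
Variables (R : realType) (n : nat) (B : {linear 'cV[R]_n -> 'M[R]_n}).
Hypothesis B2 : two_step B.
Implicit Types x y : 'cV[R]_n.
Variable Z : pred 'I_n.
Hypothesis ad_out : forall x y i, ~~ Z i -> (B x *m y) i 0 = 0.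
Hypothesis ad_central : forall x : 'cV[R]_n, (forall i, ~~ Z i -> x i 0 = 0) -> B x = 0.
Variable c : R.
Hypothesis c0 : 0 < c.
Hypothesis ad_int : forall i r s, c / 2 * B (basis_vec R r) i s \is a Num.int.

Definition int_lattice : set 'cV[R]_n :=
  [set x : 'cV[R]_n | forall i, x i 0 / c \is a Num.int].

Definition cube : set 'cV[R]_n := [set x : 'cV[R]_n | forall i, 0 <= x i 0 <= c].

(** The bound n c replaces the sharper sqrt(n) c to avoid a square root. *)
Lemma cube_norm x : cube x -> (x^T *m x) 0 0 <= (n%:R * c) ^+ 2.
Proof.
move=> bx; rewrite mxE; apply: (@le_trans _ _ (\sum_(i < n) c ^+ 2)).
  apply: ler_sum => i _; rewrite mxE -expr2; have /andP[x0 xc] := bx i.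
  by rewrite ler_sqr ?nnegrE// (le_trans x0 xc).
rewrite sumr_const card_ord exprMn -[leLHS]mulr_natl ler_wpM2r ?sqr_ge0//.
by rewrite -natrX ler_nat; case: (n) => // k; rewrite expnS expn1 leq_pmull.
Qed.

Lemma cube_compact : compact cube.
Proof.
have cK : compact [set v : 'rV[R]_n | forall i, `[0, c]%classic (v ord0 i)].
  by apply: (@rV_compact R n (fun=> `[0, c]%classic)) => i; exact: segment_compact.
have -> : cube = (fun v : 'rV[R]_n => v^T) @`
    [set v : 'rV[R]_n | forall i, `[0, c]%classic (v ord0 i)].
  apply/seteqP; split=> [x bx|_ [v bv <-] i]; last first.
    by rewrite mxE; have := bv i; rewrite /= in_itv.
  exists x^T; last by rewrite trmxK.
  by move=> i /=; rewrite mxE in_itv/=; exact: bx.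
apply: continuous_compact cK; apply: continuous_subspaceT => v.
apply: mx_continuous => i j; rewrite (_ : (fun u => _) = (fun u : 'rV[R]_n => u j i)).
  exact: (@coord_continuous R 1 n j i v).
by apply/funext => u; rewrite mxE.
Qed.

Lemma ad_bilin x y i :
  (B x *m y) i 0 = \sum_s \sum_r x r 0 * y s 0 * B (basis_vec R r) i s.
Proof.
rewrite mxE; apply: eq_bigr => s _.
rewrite {1}[x]basis_vec_sum linear_sum summxE big_distrl /=; apply: eq_bigr => r _.
by rewrite linearZ mxE mulrAC.
Qed.

(** For x = c x' and y = c y' with x', y' integral, [x, y] / 2 is c times (c / 2) [x', y']: hence
    the factor [c / 2] in [ad_int]. *)
Lemma int_lattice_ad x y i : int_lattice x -> int_lattice y ->
  (2^-1 *: (B x *m y)) i 0 / c \is a Num.int.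
Proof.
move=> gx gy; rewrite mxE ad_bilin.
have -> : 2^-1 * (\sum_s \sum_r x r 0 * y s 0 * B (basis_vec R r) i s) / c =
    \sum_s \sum_r (x r 0 / c) * (y s 0 / c) * (c / 2 * B (basis_vec R r) i s).
  rewrite mulrC mulrA mulr_sumr; apply: eq_bigr => s _.
  rewrite mulr_sumr; apply: eq_bigr => r _; field.
  by rewrite gt_eqF.
apply: rpred_sum => s _; apply: rpred_sum => r _; apply: rpredM; last exact: ad_int.
by apply: rpredM; [exact: gx|exact: gy].
Qed.

Lemma int_lattice_ltrans x y :
  int_lattice x -> int_lattice y -> int_lattice (ltrans B x y).
Proof.
move=> gx gy i; rewrite mxE [X in X + _]mxE !mulrDl.
by rewrite !rpredD//; exact: int_lattice_ad.
Qed.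

(** A coordinate of [x / c] that is not an integer lies strictly between two consecutive ones, an
    open condition. *)
Lemma int_lattice_closed x : ~ int_lattice x -> \forall y \near x, ~ int_lattice y.
Proof.
move=> /existsNP[i /negP xi].
have cf : {for x, continuous (fun y : 'cV[R]_n => y i 0 / c)}.
  by apply: continuousM; [exact: coord_continuous|exact: cst_continuous].
set m := Num.floor (x i 0 / c).
have mlt : m%:~R < x i 0 / c.
  by rewrite lt_neqAle floor_le andbT -intrEfloor.
have ltm : x i 0 / c < (m + 1)%:~R by rewrite floorD1_gt.
have : nbhs x ((fun y : 'cV[R]_n => y i 0 / c) @^-1` `]m%:~R, (m + 1)%:~R[%classic).
  by apply: cf; apply: near_in_itvoo; rewrite in_itv/= mlt.
apply: filterS => y /=; rewrite in_itv/= => /andP[y1 y2] /(_ i)/intrP[k yk].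
by move: y1 y2; rewrite yk !ltr_int; lia.
Qed.

Lemma int_lattice_lattice : lattice B int_lattice cube.
Proof.
split.
- by move=> i; rewrite mxE mul0r.
- exact: int_lattice_ltrans.
- by move=> x gx i; rewrite mxE mulNr rpredN.
- exact: int_lattice_closed.
- near=> x; move=> gx.
  have xc : `|x| < c by near: x; exact: (@nbhs0_lt _ 'cV[R]_n).
  apply/colP => i; rewrite mxE; have /intrP[k xk] := gx i.
  have : `|x i 0 / c| < 1.
    rewrite normrM normfV (gtr0_norm c0) ltr_pdivrMr// mul1r.
    by apply: le_lt_trans xc; exact: mx_coord_le_norm.
  rewrite xk -intr_norm -[1]/(1%:~R) ltr_int => k1.
  have k0 : k = 0 by lia.
  move: xk; rewrite k0 => /eqP; rewrite mulf_eq0 invr_eq0 (gt_eqF c0) orbF.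
  by move/eqP.
- exact: cube_compact.
- move=> x; pose fl (y : 'cV[R]_n) i := - (c * (Num.floor (y i 0 / c))%:~R).
  have flP y i : 0 <= fl y i + y i 0 <= c.
    have -> : fl y i + y i 0 = c * (y i 0 / c - (Num.floor (y i 0 / c))%:~R).
      by rewrite /fl; field; rewrite gt_eqF.
    rewrite mulr_ge0 ?subr_ge0 ?floor_le ?(ltW c0)//= ler_piMr ?(ltW c0)//.
    by rewrite lerBlDl; have := floorD1_gt (y i 0 / c); rewrite intrD => /ltW.
  have flG y : int_lattice (\col_i fl y i).
    move=> i; rewrite mxE /fl -mulrN mulrAC divff ?gt_eqF// mul1r rpredN.
    exact: intr_int.
  (* Translating by [fl x] brings the coordinates outside [Z] into [0, c] but adds half a bracket to
     those in [Z]; the latter are corrected by [d], which is central and so changes nothing else. *)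
  pose x1 := ltrans B (\col_i fl x i) x.
  pose d := \col_i (if Z i then fl x1 i else 0).
  have dG : int_lattice d.
    move=> i; rewrite mxE; case: ifP => _; last by rewrite mul0r.
    by have := flG x1 i; rewrite mxE.
  have Bd : B d = 0 by apply: ad_central => i /negbTE; rewrite mxE => ->.
  exists (ltrans B d (\col_i fl x i)).
    by apply: int_lattice_ltrans.
  have x1E i : ~~ Z i -> x1 i 0 = fl x i + x i 0.
    move=> Zi; rewrite /x1 /ltrans mxE [X in X + _]mxE [X in _ + X]mxE ad_out//.
    by rewrite mulr0 addr0 mxE.
  rewrite (ltransA B2) -/x1 => i; rewrite /ltrans Bd mul0mx scaler0 addr0.
  rewrite mxE [d i 0]mxE; case: ifPn => Zi; first exact: flP.
  by rewrite add0r x1E//; exact: flP.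
Unshelve. all: by end_near. Qed.

End IntegerLattice.

Section NonIsometric.
Variables (R : realType) (n : nat).

Let quotient br J c := @quotient_structure R n (two_step_group br)
  (@int_lattice R n c) (left_invariant br J).

(* The coordinate i0 projects the second quotient to the circle R / c' Z without *)
(* expanding lengths, which bounds its diameter from below by a multiple of c',  *)
(* whereas the cube bounds the diameter of the first one from above.             *)
Lemma int_lattices_isometric (B B' : {linear 'cV[R]_n -> 'M[R]_n})
    br br' (i0 : 'I_n) (c c' : R) J J' :
  two_step B -> two_step B' ->
  (forall x y : 'cV[R]_n, br x y = B x *m y) ->
  (forall x y : 'cV[R]_n, br' x y = B' x *m y) ->
  lattice B (@int_lattice R n c) (@cube R n c) ->
  lattice B' (@int_lattice R n c') (@cube R n c') ->
  0 < c -> 0 < c' ->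
  (forall x y : 'cV[R]_n, (B' x *m y) i0 0 = 0) ->
  isometric (met (quotient br J c)) (met (quotient br' J' c')) ->
  c' <= 2 * n%:R * pi * c.
Proof.
move=> B2 B2' brE brE' L L' c0 c'0 ad0 iso.
have Gam0 x : @int_lattice R n c' x -> exists k : int, x i0 0 = c' * k%:~R.
  by move=> /(_ i0)/intrP[k xk]; exists k; rewrite -xk; field; rewrite gt_eqF.
have [psi [cpsi [p [q psiE]]]] := quotient_wave B2' brE' L' c'0 ad0 Gam0.
have mE b : met (quotient br J c) b = inv_metric B.
  exact: (left_invariant_met B2 brE).
have mE' b : met (quotient br' J' c') b = inv_metric B'.
  exact: (left_invariant_met B2' brE').
have nc : 0 <= n%:R * c by rewrite mulr_ge0// ltW.
have osc := quotient_oscillation B2 brE L nc (@cube_norm R n c).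
have mQ := quotient_manifold B2' brE' L'.
have := @isometric_oscillation R n _ _ _ _ (2 * (n%:R * c)) psi p q mQ iso.
rewrite psiE => H; have : c' / pi <= 2 * (n%:R * c).
  apply: H => [phi cphi|a u au]; last by have := cpsi a u au; rewrite mE'.
  by apply: osc => a u au; have := cphi a u au; rewrite mE.
have pi0 := pi_gt0 R; rewrite ler_pdivrMr// => /le_trans; apply.
by rewrite le_eqVlt; apply/orP; left; apply/eqP; ring.
Qed.

End NonIsometric.

(** * The families of the theorem *)

Section QuaternionMatrices.
Variable R : realType.
Implicit Types (q x y : 'cV[R]_4).

Lemma qc_basis_vec (c : 'I_4) k : (k < 4)%N -> qc (basis_vec R c) k = (k == c)%:R.
Proof. by move=> k4; rewrite /qc mxE -val_eqE /= inordK// andbT. Qed.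

Lemma lmulqE q (r c : 'I_4) : lmulq q r c = nth 0 (nth [::]
  [:: [:: qc q 0; - qc q 1; - qc q 2; - qc q 3];
      [:: qc q 1; qc q 0; - qc q 3; qc q 2];
      [:: qc q 2; qc q 3; qc q 0; - qc q 1];
      [:: qc q 3; - qc q 2; qc q 1; qc q 0]] r) c.
Proof.
rewrite !mxE !qc_basis_vec//.
by case: r => [[|[|[|[|r]]]] //= _]; case: c => [[|[|[|[|c]]]] //= _]; ring.
Qed.

Lemma rmulqE q (r c : 'I_4) : rmulq q r c = nth 0 (nth [::]
  [:: [:: qc q 0; - qc q 1; - qc q 2; - qc q 3];
      [:: qc q 1; qc q 0; qc q 3; - qc q 2];
      [:: qc q 2; - qc q 3; qc q 0; qc q 1];
      [:: qc q 3; qc q 2; - qc q 1; qc q 0]] r) c.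
Proof.
rewrite !mxE !qc_basis_vec//.
by case: r => [[|[|[|[|r]]]] //= _]; case: c => [[|[|[|[|c]]]] //= _]; ring.
Qed.

(** Associativity of the quaternions, checked on entries; it puts [leftL] in the commutant of the
    [J_i]. *)
Lemma lmulq_rmulqC x y : lmulq x *m rmulq y = rmulq y *m lmulq x.
Proof.
apply/matrixP => r c; rewrite !mxE !big_ord_recl !big_ord0 !lmulqE !rmulqE.
by case: r => [[|[|[|[|r]]]] //= _]; case: c => [[|[|[|[|c]]]] //= _]; ring.
Qed.

Lemma lmulq_skew q : qc q 0 = 0 -> (lmulq q)^T = - lmulq q.
Proof.
move=> q0; apply/matrixP => r c; rewrite mxE [RHS]mxE !lmulqE.
by case: r => [[|[|[|[|r]]]] //= _]; case: c => [[|[|[|[|c]]]] //= _]; rewrite ?q0; ring.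
Qed.

Lemma rmulq_skew q : qc q 0 = 0 -> (rmulq q)^T = - rmulq q.
Proof.
move=> q0; apply/matrixP => r c; rewrite mxE [RHS]mxE !rmulqE.
by case: r => [[|[|[|[|r]]]] //= _]; case: c => [[|[|[|[|c]]]] //= _]; rewrite ?q0; ring.
Qed.

End QuaternionMatrices.

Section Blocks.
Variables (R : realType) (p : nat).
Implicit Types A C : nat -> 'M[R]_4.

Lemma sum_block (F : nat -> R) b : (b < p)%N ->
  \sum_(k < 4 * p | (k %/ 4 == b)%N) F k = \sum_(s < 4) F (4 * b + s)%N.
Proof.
move=> bp; rewrite -(big_mkord (fun k => k %/ 4 == b)%N F).
have b4 : (4 * b + 4 <= 4 * p)%N by lia.
rewrite (big_cat_nat (n := (4 * b)%N))//=; last by lia.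
rewrite (big_cat_nat (m := (4 * b)%N) (n := (4 * b + 4)%N))//=; last by lia.
rewrite big_nat_cond big1 ?add0r => [|k]; last by lia.
rewrite [X in _ + X]big_nat_cond [X in _ + X]big1 ?addr0 => [|k]; last by lia.
rewrite -{1}[(4 * b)%N]add0n big_addn addKn big_mkord.
by apply: eq_big => [s|s _]; [have := ltn_ord s; lia|rewrite addnC].
Qed.

Lemma mul_blocks A C : blocks p A *m blocks p C = blocks p (fun b => A b *m C b).
Proof.
apply/matrixP => r c; rewrite !mxE.
have rp : (r %/ 4 < p)%N by have := ltn_ord r; lia.
pose F k := A (r %/ 4)%N (inord (r %% 4)) (inord (k %% 4)) *
  (if (k %/ 4 == c %/ 4)%N then C (k %/ 4)%N (inord (k %% 4)) (inord (c %% 4)) else 0).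
transitivity (\sum_(k < 4 * p | (k %/ 4 == r %/ 4)%N) F k).
  rewrite [RHS]big_mkcond; apply: eq_bigr => k _; rewrite !mxE [RHS]/= eq_sym /F.
  by case: ifP => _ //; rewrite mul0r.
have d4 (s : 'I_4) : ((4 * (r %/ 4) + s) %/ 4 = r %/ 4)%N by have := ltn_ord s; lia.
have m4 (s : 'I_4) : inord ((4 * (r %/ 4) + s) %% 4) = s.
  by apply: val_inj; rewrite /= inordK; have := ltn_ord s; lia.
rewrite sum_block// /F; case: ifPn => rc; last first.
  by apply: big1 => s _; rewrite d4 (negbTE rc) mulr0.
by apply: eq_bigr => s _; rewrite d4 rc m4.
Qed.

Lemma tr_blocks A : (blocks p A)^T = blocks p (fun b => (A b)^T).
Proof.
apply/matrixP => r c; rewrite !mxE eq_sym; case: eqP => // e.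
by rewrite e.
Qed.

Lemma opp_blocks A : - blocks p A = blocks p (fun b => - A b).
Proof.
by apply/matrixP => r c; rewrite !mxE; case: ifP => _; rewrite ?mxE ?oppr0.
Qed.

Lemma blocks1 : blocks p (fun=> 1%:M) = 1%:M :> 'M[R]_(4 * p).
Proof.
apply/matrixP => r c; rewrite !mxE -!val_eqE /= !inordK ?ltn_mod//.
have -> : (r == c :> nat) = ((r %/ 4 == c %/ 4) && (r %% 4 == c %% 4))%N.
  by apply/idP/idP => [/eqP->|/andP[/eqP h1 /eqP h2]]; [rewrite !eqxx|lia].
by case: eqP.
Qed.

End Blocks.

Section ComplexStructures.
Variable R : realType.

Lemma rmulq_sqr (q : 'cV[R]_4) : qc q 0 = 0 ->
  qc q 1 ^+ 2 + qc q 2 ^+ 2 + qc q 3 ^+ 2 = 1 -> rmulq q *m rmulq q = - 1%:M.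
Proof.
move=> q0 nq; apply/matrixP => r c.
transitivity (- ((r == c)%:R * (qc q 1 ^+ 2 + qc q 2 ^+ 2 + qc q 3 ^+ 2))).
  rewrite -val_eqE !mxE !big_ord_recl !big_ord0 !rmulqE /=.
  by case: r => [[|[|[|[|r]]]] //= _]; case: c => [[|[|[|[|c]]]] //= _];
    rewrite ?q0; ring.
by rewrite nq !mxE mulr1.
Qed.

Let h (i : nat) : 'cV[R]_4 := [:: qi R; qj R; - qk R]`_i.

Lemma qc_h i k : (i < 3)%N -> (k < 4)%N ->
  qc (h i) k = (k == i.+1)%:R * (-1) ^+ (i == 2).
Proof.
move=> i3 k4; rewrite /h /qc; move: i i3 => [|[|[|i]]] //= _;
 by rewrite /qi /qj /qk /qunit !mxE inordK//= ?mulr1 ?expr1 ?mulrN1.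
Qed.

(** Right multiplication reverses products: R_i R_j = R_(ji) = R_(-k), whence the sign of the third
    structure. *)
Lemma rmul_quaternionic : quaternionic (fun i : 'I_3 => rmulq (h i)).
Proof.
split=> [i||].
- have := ltn_ord i; move: (nat_of_ord i) => k k3.
  apply: rmulq_sqr; rewrite !qc_h//=; first by rewrite mul0r.
  by move: k k3 => [|[|[|k]]] //= _; rewrite ?expr0 ?expr1; ring.
- apply/matrixP => r c; rewrite mxE !big_ord_recl !big_ord0 !rmulqE !qc_h//=.
  by case: r => [[|[|[|[|r]]]] //= _]; case: c => [[|[|[|[|c]]]] //= _];
    rewrite ?expr0 ?expr1; ring.
- apply/matrixP => r c; rewrite mxE [RHS]mxE !big_ord_recl !big_ord0 !rmulqE !qc_h//=.
  by case: r => [[|[|[|[|r]]]] //= _]; case: c => [[|[|[|[|c]]]] //= _];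
    rewrite ?expr0 ?expr1; ring.
Qed.

Lemma rmul_orthogonal (i : 'I_3) : (rmulq (h i))^T *m rmulq (h i) = 1%:M.
Proof.
rewrite rmulq_skew ?qc_h//= ?mul0r// mulNmx.
by have [-> _ _] := rmul_quaternionic; rewrite opprK.
Qed.

Lemma center_extension_exists : exists K : 'I_3 -> 'M[R]_4, center_extension K.
Proof.
exists (fun i : 'I_3 => rmulq (h i)); split; first exact: rmul_quaternionic.
exact: rmul_orthogonal.
Qed.

Lemma Hp_quaternionic p : quaternionic (@Hp_structure R p).
Proof.
have [JJ J01 J10] := rmul_quaternionic.
split=> [i||]; rewrite /Hp_structure mul_blocks.
- by rewrite -blocks1 opp_blocks; congr blocks; apply/funext => b; exact: JJ.
- by congr blocks; apply/funext => b; exact: J01.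
- by rewrite opp_blocks; congr blocks; apply/funext => b; exact: J10.
Qed.

Lemma Hp_orthogonal p i : (@Hp_structure R p i)^T *m @Hp_structure R p i = 1%:M.
Proof.
rewrite /Hp_structure tr_blocks mul_blocks -blocks1.
by congr blocks; apply/funext => b; exact: rmul_orthogonal.
Qed.

Lemma leftL_Hp p (q : nat -> 'cV[R]_4) i :
  leftL p q *m Hp_structure R p i = Hp_structure R p i *m leftL p q.
Proof.
rewrite /Hp_structure /leftL !mul_blocks.
by congr blocks; apply/funext => b; exact: lmulq_rmulqC.
Qed.

Lemma leftL_skew p (q : nat -> 'cV[R]_4) : (forall b, qc (q b) 0 = 0) ->
  (leftL p q)^T = - leftL p q.
Proof.
move=> q0; rewrite /leftL tr_blocks opp_blocks.
by congr blocks; apply/funext => b; exact: lmulq_skew.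
Qed.

Lemma leftL_int p (q : nat -> 'cV[R]_4) (a : R) :
  (forall b k, (k < 4)%N -> a * qc (q b) k \is a Num.int) ->
  forall r c, a * leftL p q r c \is a Num.int.
Proof.
move=> qi r c; rewrite mxE; case: ifP => _; last by rewrite mulr0.
rewrite lmulqE; move: (inord _) (inord _) => r' c'.
by case: r' => [[|[|[|[|r']]]] //= _]; case: c' => [[|[|[|[|c']]]] //= _];
  rewrite ?mulrN ?rpredN; exact: qi.
Qed.

End ComplexStructures.

(** * The Lie algebra defined by j and its HKT data *)

Section NilAlgebra.
Variables (R : realType) (p m : nat) (j : 'I_m -> 'M[R]_(4 * p)).
Let d := (4 * p + (4 - m + m))%N.
Implicit Types x y z : 'cV[R]_d.

Definition bracket_mx (v : 'cV[R]_(4 * p)) : 'M[R]_(m, 4 * p) :=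
  \matrix_(r < m) (j r *m v)^T.

Definition nil_ad x : 'M[R]_d :=
  block_mx 0 0 (col_mx 0 (bracket_mx (usubmx x))) 0.

Definition jz (z : 'cV[R]_m) : 'M[R]_(4 * p) := \sum_r z r 0 *: j r.

(* the connection with nabla_X = 0 for X in R^(4p), and nabla_z = - j_z on      *)
(* R^(4p) and 0 on the center for z in R^m                                      *)
Definition nil_Gam x : 'M[R]_d :=
  block_mx (- jz (dsubmx (dsubmx x))) 0 0 0.

Lemma bracket_mxP : linear bracket_mx.
Proof.
move=> a u v; apply/row_matrixP => r; rewrite linearP /= !rowK.
by rewrite mulmxDr -scalemxAr linearP.
Qed.

Lemma nil_adP : linear nil_ad.
Proof.
move=> a x y; rewrite /nil_ad linearP bracket_mxP /=.
rewrite scale_block_mx add_block_mx !scaler0 !addr0.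
by rewrite scale_col_mx add_col_mx scaler0 addr0.
Qed.

HB.instance Definition _ := GRing.isLinear.Build _ _ _ _ nil_ad nil_adP.

Lemma jzP : linear jz.
Proof.
move=> a u v; rewrite /jz scaler_sumr -big_split; apply: eq_bigr => r _ /=.
by rewrite !mxE scalerDl scalerA.
Qed.

Lemma nil_GamP : linear nil_Gam.
Proof.
move=> a x y; rewrite /nil_Gam !linearP jzP /=.
rewrite scale_block_mx add_block_mx !scaler0 !addr0.
by rewrite opprD scalerN.
Qed.

HB.instance Definition _ := GRing.isLinear.Build _ _ _ _ nil_Gam nil_GamP.

Lemma nil_ad_mul x y :
  nil_ad x *m y = col_mx 0 (col_mx 0 (bracket_mx (usubmx x) *m usubmx y)).
Proof.
rewrite -[in LHS](vsubmxK y) /nil_ad mul_block_col !mul0mx !addr0.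
by rewrite mul_col_mx mul0mx.
Qed.

Lemma nil_Gam_mul x y :
  nil_Gam x *m y = col_mx (- jz (dsubmx (dsubmx x)) *m usubmx y) 0.
Proof. by rewrite -[in LHS](vsubmxK y) /nil_Gam mul_block_col !mul0mx !addr0. Qed.

Lemma mul_tr_col a b (v : 'cV[R]_(a + b)) (u : 'cV[R]_a) (w : 'cV[R]_b) :
  v^T *m col_mx u w = (usubmx v)^T *m u + (dsubmx v)^T *m w.
Proof. by rewrite -[in LHS](vsubmxK v) tr_col_mx mul_row_col. Qed.

Lemma nil_bracketE x y : nil_bracket j x y = nil_ad x *m y.
Proof.
rewrite nil_ad_mul /nil_bracket; congr col_mx; congr col_mx.
apply/colP => r; rewrite mxE [RHS]mxE mxE.
by apply: eq_bigr => k _; rewrite !mxE.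
Qed.

Hypothesis j_skew : forall r, (j r)^T = - j r.

Lemma bracket_mx_anti u v : bracket_mx u *m v = - (bracket_mx v *m u).
Proof.
apply/row_matrixP => r; rewrite linearN /= !row_mul !rowK.
rewrite -[LHS]mx11_tr trmx_mul trmxK [in RHS]trmx_mul j_skew.
by rewrite mulmxN mulNmx opprK mulmxA.
Qed.

Lemma nil_two_step : two_step nil_ad.
Proof.
split=> x y.
  rewrite /= -[in LHS](vsubmxK y) -[in RHS](vsubmxK x) /nil_ad !mul_block_col.
  rewrite !mul0mx !addr0 !mul_col_mx !mul0mx !opp_col_mx !oppr0.
  by rewrite bracket_mx_anti.
by rewrite /= /nil_ad mulmx_block !mulmx0 !mul0mx !addr0 block_mx0.
Qed.

Lemma nil_ad_out x y (i : 'I_d) : ~~ (4 * p <= i)%N -> (nil_ad x *m y) i 0 = 0.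
Proof.
move=> ip; rewrite -nil_bracketE /nil_bracket.
case: (split_ordP i) ip => [k ->|k ->] /=; last by rewrite leq_addr.
by move=> _; rewrite col_mxEu mxE.
Qed.

Lemma nil_ad_central x :
  (forall i : 'I_d, ~~ (4 * p <= i)%N -> x i 0 = 0) -> nil_ad x = 0.
Proof.
move=> x0; rewrite /nil_ad; have -> : usubmx x = 0.
  apply/colP => k; rewrite !mxE x0//= -ltnNge; exact: ltn_ord.
by rewrite (_ : bracket_mx 0 = 0) ?col_mx0 ?block_mx0//; apply/row_matrixP => r;
  rewrite rowK mulmx0 trmx0 row0.
Qed.

Lemma nil_ad_int (a : R) : (forall r k l, a * j r k l \is a Num.int) ->
  forall i r s, a * nil_ad (basis_vec R r) i s \is a Num.int.
Proof.
move=> ja i r s; rewrite /nil_ad.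
have z0 : a * 0 \is a Num.int by rewrite mulr0.
have [k ->|k ->] := split_ordP i; have [l ->|l ->] := split_ordP s.
- by rewrite block_mxEul mxE.
- by rewrite block_mxEur mxE.
- rewrite block_mxEdl.
  have [q ->|q ->] := split_ordP k; first by rewrite col_mxEu mxE.
  rewrite col_mxEd mxE mxE; have [t ->|t ->] := split_ordP r.
    have -> : usubmx (basis_vec R (lshift (4 - m + m) t)) = basis_vec R t.
      by apply/colP => t'; rewrite !mxE (inj_eq (@lshift_inj _ _)).
    by rewrite mulmx_basis_vec; exact: ja.
  have -> : usubmx (basis_vec R (rshift (4 * p) t)) = 0 :> 'cV[R]_(4 * p).
    by apply/colP => t'; rewrite !mxE eq_lrshift.
  by rewrite mulmx0 mxE.
- by rewrite block_mxEdr mxE.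
Qed.

Hypothesis j_comm : forall r i, j r *m Hp_structure R p i = Hp_structure R p i *m j r.
Variable K : 'I_3 -> 'M[R]_(4 - m + m).
Hypothesis KE : center_extension K.

Let J := J_at_one p K.

Lemma nil_quaternionic : quaternionic J.
Proof.
have [KK K01 K10] := KE.1; have [HH H01 H10] := @Hp_quaternionic R p.
split=> [i||]; rewrite /J /J_at_one mulmx_block !mulmx0 !mul0mx !addr0 !add0r.
- by rewrite HH KK (@scalar_mx_block _ (4 * p) (4 - m + m)) opp_block_mx !oppr0.
- by congr block_mx; [exact: H01|exact: K01].
- rewrite opp_block_mx !oppr0.
  by congr block_mx; [exact: H10|exact: K10].
Qed.

Lemma nil_orthogonal i : (J i)^T *m J i = 1%:M.
Proof.
rewrite /J /J_at_one tr_block_mx !trmx0 mulmx_block !mulmx0 !mul0mx !addr0 !add0r.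
by rewrite Hp_orthogonal (KE.2 i) -scalar_mx_block.
Qed.

(** This is [Jx, Jy] = [x, y]: [j r] commutes with the orthogonal matrix [Hp_structure R p i]. *)
Lemma bracket_mxJ i v :
  bracket_mx (Hp_structure R p i *m v) *m Hp_structure R p i = bracket_mx v.
Proof.
apply/row_matrixP => r; rewrite row_mul !rowK mulmxA j_comm -mulmxA trmx_mul.
by rewrite -mulmxA Hp_orthogonal mulmx1.
Qed.

Lemma jz_skew (z : 'cV[R]_m) : (jz z)^T = - jz z.
Proof.
rewrite /jz linear_sum -sumrN; apply: eq_bigr => r _.
by rewrite linearZ /= j_skew scalerN.
Qed.

Lemma jz_comm (z : 'cV[R]_m) i :
  jz z *m Hp_structure R p i = Hp_structure R p i *m jz z.
Proof.
rewrite /jz mulmx_suml mulmx_sumr; apply: eq_bigr => r _.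
by rewrite -scalemxAl -scalemxAr j_comm.
Qed.

Lemma jz_bracket (z : 'cV[R]_m) (u v : 'cV[R]_(4 * p)) :
  z^T *m (bracket_mx u *m v) = - (u^T *m (jz z *m v)).
Proof.
rewrite /jz mulmx_suml mulmx_sumr -sumrN.
apply/matrixP => a b; rewrite !ord1 mxE summxE; apply: eq_bigr => r _.
rewrite -scalemxAl -scalemxAr -scalerN [RHS]mxE mxE; congr (_ * _).
transitivity ((row r (bracket_mx u *m v)) 0 0); first by rewrite [RHS]mxE.
by rewrite row_mul rowK trmx_mul j_skew mulmxN mulNmx mulmxA.
Qed.

Lemma nil_alt x y z :
  x^T *m (nil_Gam y *m z - nil_Gam z *m y - nil_ad y *m z) =
  - (y^T *m (nil_Gam x *m z - nil_Gam z *m x - nil_ad x *m z)).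
Proof.
have E x' y' z' : x'^T *m (nil_Gam y' *m z' - nil_Gam z' *m y' - nil_ad y' *m z') =
  - ((usubmx x')^T *m (jz (dsubmx (dsubmx y')) *m usubmx z'))
  + (usubmx x')^T *m (jz (dsubmx (dsubmx z')) *m usubmx y')
  + (usubmx y')^T *m (jz (dsubmx (dsubmx x')) *m usubmx z').
  rewrite !nil_Gam_mul nil_ad_mul !opp_col_mx !add_col_mx !oppr0 !addr0 !add0r.
  rewrite !mul_tr_col mulmx0 add0r mulmxN jz_bracket opprK mulmxBr !mulNmx !mulmxN.
  by rewrite opprK.
rewrite !E.
have S w : forall u v : 'cV[R]_(4 * p), u^T *m (jz w *m v) = - (v^T *m (jz w *m u)).
  move=> u v; rewrite -[LHS]mx11_tr !trmx_mul trmxK jz_skew.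
  by rewrite mulmxN mulNmx mulmxA.
(* Exchanging [x] and [y] swaps the first and third terms of [E] up to sign; only the middle one
   needs the skewness of j. *)
rewrite (S (dsubmx (dsubmx z)) (usubmx y)).
by mxring.
Qed.

Lemma nil_hkt : hkt_data nil_ad J nil_Gam.
Proof.
split.
- exact: nil_quaternionic.
- exact: nil_orthogonal.
- move=> i x y; rewrite /= /nil_ad /J /J_at_one !mulmx_block.
  by rewrite !mulmx0 !mul0mx !addr0 !mul0mx !addr0 block_mx0.
- move=> i x; have -> : J i *m x =
      col_mx (Hp_structure R p i *m usubmx x) (K i *m dsubmx x).
    by rewrite /J /J_at_one -[in LHS](vsubmxK x) mul_block_col !mul0mx addr0 add0r.
  rewrite /= /nil_ad /J /J_at_one col_mxKu.
  by rewrite mulmx_block !mulmx0 !mul0mx !addr0 mul_col_mx mul0mx bracket_mxJ.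
- move=> x; rewrite /= /nil_Gam tr_block_mx !trmx0 opp_block_mx !oppr0.
  by rewrite linearN /= jz_skew.
- move=> i x; rewrite /= /nil_Gam /J /J_at_one !mulmx_block !mulmx0 !mul0mx !addr0.
  by rewrite mulNmx mulmxN jz_comm.
- exact: nil_alt.
Qed.

End NilAlgebra.

Section NilStructures.
Variables (R : realType) (p m : nat).
Let d := (4 * p + (4 - m + m))%N.

Record sp_valued (j : 'I_m -> 'M[R]_(4 * p)) : Prop := SpValued {
  sp_skew : forall r, (j r)^T = - j r;
  sp_comm : forall r i, j r *m Hp_structure R p i = Hp_structure R p i *m j r }.

Definition integral_for (j : 'I_m -> 'M[R]_(4 * p)) (c : R) : Prop :=
  forall r k l, c / 2 * j r k l \is a Num.int.

Variable K : 'I_3 -> 'M[R]_(4 - m + m).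
Hypothesis KE : center_extension K.

Let nil_quotient j c := @quotient_structure R d (nil_group j)
  (@int_lattice R d c) (nil_structure j K).

Lemma nil_HKT j : sp_valued j ->
  HKT (nil_structure j K) /\ homogeneous (nil_structure j K).
Proof.
case=> sk cm; have B2 := nil_two_step sk; have D := nil_hkt sk cm KE.
have brE := nil_bracketE j.
split; first exact: (left_invariant_HKT B2 brE D).
exact: (left_invariant_homogeneous B2 brE).
Qed.

Lemma nil_lattice j c : sp_valued j -> 0 < c -> integral_for j c ->
  lattice (nil_ad j) (@int_lattice R d c) (@cube R d c).
Proof.
case=> sk cm c0 jc; apply: (int_lattice_lattice (nil_two_step sk)
  (Z := fun i : 'I_d => (4 * p <= i)%N)) => //.
- by move=> x y i; exact: nil_ad_out.
- exact: nil_ad_central.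
- by move=> i r s; exact: nil_ad_int.
Qed.

Lemma nil_nilmanifold j c : sp_valued j -> 0 < c -> integral_for j c ->
  HKT_nilmanifold (nil_structure j K) (@int_lattice R d c).
Proof.
move=> sj c0 jc; have L := nil_lattice sj c0 jc; case: sj => sk cm.
exact: (quotient_HKT_nilmanifold (nil_two_step sk) (nil_bracketE j) L
  (nil_hkt sk cm KE)).
Qed.

(** The coordinate [i0] is the first one of R^(4p), where brackets have no component. *)
Lemma nil_isometric_le j j' c c' : (0 < p)%N -> sp_valued j -> sp_valued j' ->
  0 < c -> 0 < c' -> integral_for j c -> integral_for j' c' ->
  isometric (met (nil_quotient j c)) (met (nil_quotient j' c')) ->
  c' <= 2 * d%:R * pi * c.
Proof.
move=> p0 sj sj' c0 c'0 jc j'c'.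
have L := nil_lattice sj c0 jc; have L' := nil_lattice sj' c'0 j'c'.
case: sj => sk _; case: sj' => sk' _.
have p4 : (0 < 4 * p)%N by lia.
apply: (int_lattices_isometric (i0 := lshift (4 - m + m) (Ordinal p4))
  (nil_two_step sk) (nil_two_step sk') (nil_bracketE j) (nil_bracketE j') L L' c0 c'0).
by move=> x y; apply: nil_ad_out; rewrite /= -ltnNge.
Qed.

Lemma nil_isometric_sym j j' c c' : sp_valued j -> sp_valued j' ->
  0 < c -> 0 < c' -> integral_for j c -> integral_for j' c' ->
  isometric (met (nil_quotient j c)) (met (nil_quotient j' c')) ->
  isometric (met (nil_quotient j' c')) (met (nil_quotient j c)).
Proof.
move=> sj sj' c0 c'0 jc j'c'.
have L := nil_lattice sj c0 jc; have L' := nil_lattice sj' c'0 j'c'.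
case: sj => sk _; case: sj' => sk' _.
apply: isometric_sym.
  exact: (quotient_manifold (nil_two_step sk) (nil_bracketE j) L).
exact: (quotient_manifold (nil_two_step sk') (nil_bracketE j') L').
Qed.

(* Lattices dilated by distinct powers of this factor have non-isometric        *)
(* quotients, by nil_isometric_le.                                              *)
Definition spread : nat := (Num.trunc (2 * d%:R * pi : R)).+3.

Lemma spread_gt : 2 * d%:R * pi < spread%:R :> R.
Proof.
apply: (lt_le_trans (truncnS_gt _)); rewrite ler_nat ltnS; exact: leqW (leqnSn _).
Qed.

(** The common factor [a] cancels, and a power of [spread] is at most 2 d pi times another only if
    its exponent is no larger. Symmetry of isometry gives both inequalities. *)
Lemma nil_isometric_eq j j' a k k' : (0 < p)%N -> 0 < a ->
  sp_valued j -> sp_valued j' ->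
  let c := a * spread%:R ^+ k in let c' := a * spread%:R ^+ k' in
  integral_for j c -> integral_for j' c' ->
  isometric (met (nil_quotient j c)) (met (nil_quotient j' c')) ->
  k = k'.
Proof.
move=> p0 a0 sj sj' c c' jc jc' iso.
have s0 i : 0 < spread%:R ^+ i :> R by rewrite exprn_gt0// ltr0n.
have c0 : 0 < c by rewrite mulr_gt0.
have c'0 : 0 < c' by rewrite mulr_gt0.
have H i i' : a * spread%:R ^+ i' <= 2 * d%:R * pi * (a * spread%:R ^+ i) ->
    (i' <= i)%N.
  rewrite mulrCA ler_pM2l// => le; rewrite leqNgt; apply/negP => lt.
  have : spread%:R ^+ i' < spread%:R ^+ i.+1 :> R.
    by apply: (le_lt_trans le); rewrite exprS ltr_pM2r// spread_gt.
  by rewrite ltr_eXn2l ?ltr1n//; lia.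
apply/eqP; rewrite eqn_leq; apply/andP; split; apply: H.
  exact: (nil_isometric_le p0 sj' sj c'0 c0 jc' jc
    (nil_isometric_sym sj sj' c0 c'0 jc jc' iso)).
exact: (nil_isometric_le p0 sj sj' c0 c'0 jc jc' iso).
Qed.

End NilStructures.

(** * The two families, their lattice scales and the rational parameters *)

Section Families.
Variable R : realType.

Lemma qc_axis (a : R) k i : (i < 4)%N -> qc (a *: qunit R k) i = a * (i == k)%:R.
Proof. by move=> i4; rewrite /qc !mxE inordK. Qed.

(** Both families have this shape: the block coefficients of [j r] are real multiples of one
    imaginary unit. The vanishing real part gives skewness. *)
Lemma axis_sp p m (j : 'I_m -> 'M[R]_(4 * p)) (a : nat -> nat -> R) :
  (forall r, j r = leftL p (fun b => a r b *: qunit R r.+1)) -> sp_valued j.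
Proof.
move=> jE; split=> [r|r i]; rewrite jE; last exact: leftL_Hp.
by apply: leftL_skew => b; rewrite qc_axis// mulr0.
Qed.

Lemma axis_integral p m (j : 'I_m -> 'M[R]_(4 * p)) (a : nat -> nat -> R) c :
  (forall r, j r = leftL p (fun b => a r b *: qunit R r.+1)) ->
  (forall r b, c / 2 * a r b \is a Num.int) -> integral_for j c.
Proof.
move=> jE ca r k l; rewrite jE; apply: leftL_int => b i i4.
rewrite qc_axis// mulrA; apply: rpredM; [exact: ca|exact: rpred_nat].
Qed.

Definition coef1 p (t : R) (r b : nat) : R :=
  if (r == 1%N) && (b == p.-1) then t else 1.

Lemma j1E p t (r : 'I_2) : j1 p t r = leftL p (fun b => coef1 p t r b *: qunit R r.+1).
Proof.
case: r => [[|[|r]]] //= r2; rewrite /j1/=; congr leftL; apply/funext => b.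
  by rewrite scale1r.
by rewrite /coef1/=; case: ifP; rewrite ?scale1r.
Qed.

Definition coef2 p (t s : R) (r b : nat) : R :=
  if (r == 1%N) && (b == p.-2) then t else
  if (r == 2%N) && (b == p.-1) then s else 1.

Lemma j2E p t s (r : 'I_3) :
  j2 p t s r = leftL p (fun b => coef2 p t s r b *: qunit R r.+1).
Proof.
case: r => [[|[|[|r]]]] //= r2; rewrite /j2/=; congr leftL; apply/funext => b.
- by rewrite scale1r.
- by rewrite /coef2/=; case: ifP; rewrite ?scale1r.
- by rewrite /coef2/=; case: ifP; rewrite ?scale1r.
Qed.

Lemma denq_ratr_int (t : rat) : (denq t)%:~R * ratr t \is a @Num.int R.
Proof.
rewrite /ratr mulrC divfK ?intr_int//.
by rewrite intr_eq0 denq_neq0.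
Qed.

Definition scale1 (t : rat) : R := 2 * (denq t)%:~R.
Definition scale2 (t s : rat) : R := 2 * ((denq t)%:~R * (denq s)%:~R).

Lemma scale1_gt0 t : 0 < scale1 t.
Proof. by rewrite mulr_gt0// ltr0z. Qed.

Lemma scale2_gt0 t s : 0 < scale2 t s.
Proof. by rewrite !mulr_gt0// ltr0z. Qed.

Lemma j1_integral p t : integral_for (j1 p (ratr t)) (scale1 t).
Proof.
apply: (axis_integral (j1E p (ratr t))) => r b.
rewrite /scale1 [2 * _ / 2]mulrAC divff ?mul1r// /coef1; case: ifP => _.
  exact: denq_ratr_int.
by rewrite mulr1.
Qed.

Lemma j2_integral p t s : integral_for (j2 p (ratr t) (ratr s)) (scale2 t s).
Proof.
apply: (axis_integral (j2E p (ratr t) (ratr s))) => r b.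
rewrite /scale2 [2 * _ / 2]mulrAC divff ?mul1r// /coef2; case: ifP => _.
  by rewrite mulrAC; apply: rpredM; [exact: denq_ratr_int|exact: intr_int].
case: ifP => _; last by rewrite mulr1; apply: rpredM; exact: intr_int.
by rewrite -mulrA; apply: rpredM; [exact: intr_int|exact: denq_ratr_int].
Qed.

(** The denominator is exactly A^(k+1), so the lattice scale is geometric in [k]. *)
Definition inv_pow (A k : nat) : rat := (Posz (A ^ k.+1))%:~R^-1.

Lemma inv_pow_gt0 A k : (0 < A)%N -> 0 < inv_pow A k.
Proof. by move=> A0; rewrite invr_gt0 ltr0z ltz_nat expn_gt0 A0. Qed.

Lemma denq_inv_pow A k : (0 < A)%N -> (denq (inv_pow A k))%:~R = A%:R ^+ k.+1 :> R.
Proof.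
move=> A0; rewrite /inv_pow denqVz; last by rewrite eqz_nat -lt0n expn_gt0 A0.
by rewrite ger0_norm// -pmulrn natrX.
Qed.

Lemma inv_pow_inj A : (1 < A)%N -> injective (inv_pow A).
Proof.
move=> A1 k k' /invr_inj/eqP; rewrite eqr_int eqz_nat eqn_exp2l// => /eqP[].
exact.
Qed.

(** Keeps t below s = 1/2 in the two-parameter family; [spread] is at least 3, which provides
    [2 < A]. *)
Lemma inv_pow_lt A k : (2 < A)%N -> inv_pow A k < 2^-1.
Proof.
move=> A2; rewrite ltf_pV2 ?qualifE/= ?ltr0z ?ltz_nat ?expn_gt0 ?(ltnW (ltnW A2))//.
rewrite -[2]/(2%:~R) ltr_int ltz_nat; apply: (leq_trans A2).
by rewrite -{1}[A]expn1 leq_pexp2l// ltnW// ltnW.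
Qed.

Lemma infinite_range (T : choiceType) (f : nat -> T) :
  injective f -> infinite_set (range f).
Proof.
move=> finj; apply/infiniteP; have := @inj_card_eq _ _ [set: nat] f.
by move=> /(_ (in2W finj)); rewrite card_eq_le => /andP[].
Qed.

End Families.

Theorem theorem4p1 (R : realType) (l : nat) :
  (exists K : 'I_3 -> 'M[R]_4, center_extension K) /\
  forall K : 'I_3 -> 'M[R]_4, center_extension K ->
  ((3 <= l)%N ->
    (forall t : R, 0 < t ->
       HKT (HKT1 l.-1 K t) /\ homogeneous (HKT1 l.-1 K t)) /\
    (exists Gam : forall t : rat, set (N1 l.-1 (ratr t : R)),
       (forall t : rat, 0 < t ->
          HKT_nilmanifold (HKT1 l.-1 K (ratr t)) (Gam t)) /\
       exists P : set rat,
         [/\ infinite_set P,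
             P `<=` [set t | 0 < t] &
             forall t t', P t -> P t' -> t <> t' ->
               ~ isometric
                   (met (quotient_structure (Gam t) (HKT1 l.-1 K (ratr t))))
                   (met (quotient_structure (Gam t')
                           (HKT1 l.-1 K (ratr t'))))])) /\
  ((4 <= l)%N ->
    (forall t s : R, 0 < t -> t < s -> s < 1 ->
       HKT (HKT2 l.-1 K t s) /\ homogeneous (HKT2 l.-1 K t s)) /\
    (exists Gam : forall t s : rat, set (N2 l.-1 (ratr t : R) (ratr s)),
       (forall t s : rat, 0 < t -> t < s -> s < 1 ->
          HKT_nilmanifold (HKT2 l.-1 K (ratr t) (ratr s)) (Gam t s)) /\
       exists P : set (rat * rat),
         [/\ infinite_set P,
             P `<=` [set q | 0 < q.1 /\ q.1 < q.2 /\ q.2 < 1] &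
             forall q q', P q -> P q' -> q <> q' ->
               ~ isometric
                   (met (quotient_structure (Gam q.1 q.2)
                           (HKT2 l.-1 K (ratr q.1) (ratr q.2))))
                   (met (quotient_structure (Gam q'.1 q'.2)
                           (HKT2 l.-1 K (ratr q'.1) (ratr q'.2))))])).
Proof.
split; first exact: center_extension_exists.
move=> K KE; split=> l3.
- have p0 : (0 < l.-1)%N by lia.
  have sp t := axis_sp (@j1E R l.-1 t).
  split=> [t _|]; first exact: (@nil_HKT R l.-1 2 K KE _ (sp t)).
  exists (fun t => @int_lattice R (4 * l.-1 + (4 - 2 + 2)) (scale1 R t)); split.
    move=> t _; exact: (@nil_nilmanifold R l.-1 2 K KE _ _ (sp _)
      (scale1_gt0 R t) (@j1_integral R _ t)).
  pose A := spread R l.-1 2.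
  exists (range (inv_pow A)); split.
  + exact/infinite_range/inv_pow_inj.
  + by move=> _ [k _ <-]; exact: inv_pow_gt0.
  + move=> _ _ [k _ <-] [k' _ <-] ne.
    have E i : scale1 R (inv_pow A i) = 2 * A%:R ^+ i.+1.
      by rewrite /scale1 denq_inv_pow.
    have I i := @j1_integral R l.-1 (inv_pow A i).
    move: (I k) (I k'); rewrite !E => Ik Ik' iso; apply: ne; congr inv_pow.
    have a0 : 0 < 2 :> R by [].
    have [] := @nil_isometric_eq R l.-1 2 K _ _ 2 _ _ p0 a0 (sp _) (sp _) Ik Ik' iso.
    exact.
- have p0 : (0 < l.-1)%N by lia.
  have sp t s := axis_sp (@j2E R l.-1 t s).
  split=> [t s _ _ _|]; first exact: (@nil_HKT R l.-1 3 K KE _ (sp t s)).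
  exists (fun t s => @int_lattice R (4 * l.-1 + (4 - 3 + 3)) (scale2 R t s)); split.
    move=> t s _ _ _; exact: (@nil_nilmanifold R l.-1 3 K KE _ _ (sp _ _)
      (scale2_gt0 R t s) (@j2_integral R _ t s)).
  pose A := spread R l.-1 3.
  (* Only t varies; s is fixed at 1/2. *)
  exists (range (fun k => (inv_pow A k, 2^-1))); split.
  + by apply: infinite_range => k k' [] /inv_pow_inj; exact.
  + move=> _ [k _ <-] /=; split; first exact: inv_pow_gt0.
    by split; [exact: inv_pow_lt|rewrite invf_lt1].
  + move=> _ _ [k _ <-] [k' _ <-] ne /=.
    (* The 4 is the factor 2 of [scale2] times the denominator 2 of s. *)
    have E i : scale2 R (inv_pow A i) 2^-1 = 4 * A%:R ^+ i.+1.
      rewrite /scale2 denq_inv_pow// (_ : denq 2^-1 = 2); last exact: (@denqVz 2).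
      by ring.
    have I i := @j2_integral R l.-1 (inv_pow A i) 2^-1.
    move: (I k) (I k'); rewrite !E => Ik Ik' iso; apply: ne; congr (inv_pow _ _, _).
    have a0 : 0 < 4 :> R by [].
    have [] := @nil_isometric_eq R l.-1 3 K _ _ 4 _ _ p0 a0 (sp _ _) (sp _ _) Ik Ik' iso.
    exact.
Qed.
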